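(* Let $p>1$ and let $\varphi$ be an analytic self-map of $\mathbb{D}$ with $\varphi\in S^p$. Then the following are equivalent: (i) $D_\varphi:S^p\to S^p$ is compact; (ii) $C_\varphi:H^p\to S^p$ is compact; (iii) $DC_\varphi:H^p\to H^p$ is compact.
   Context: $\mathbb{D}$ is the open unit disk. For $p>1$, $H^p$ is the Hardy space on $\mathbb{D}$ with norm $\|g\|_{H^p}^p=\sup_{0<r<1}\int_0^{2\pi}|g(re^{i\theta})|^p\frac{d\theta}{2\pi}$; $S^p$ is the space of analytic $f$ on $\mathbb{D}$ with $f'\in H^p$, normed by $\|f\|_{S^p}=|f(0)|+\|f'\|_{H^p}$. $C_\varphi f=f\circ\varphi$, $D_\varphi f=f'\circ\varphi$, and $DC_\varphi f=(f\circ\varphi)'$. *)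

(* Defs.v *)
From HB Require Import structures.
From mathcomp Require Import all_boot all_order all_algebra.
From mathcomp Require Import all_classical all_reals all_analysis.
From mathcomp Require Import complex.
Import Order.TTheory GRing.Theory Num.Theory.
Import numFieldNormedType.Exports.

Set Implicit Arguments. Unset Strict Implicit. Unset Printing Implicit Defensive.

Local Open Scope ring_scope.
Local Open Scope classical_set_scope.

Section HardyDefs.
Variable R : realType.
Local Notation C := (complex R).

Definition in_disk (z : C) : Prop := `|z| < 1.

Definition cmod (w : C) : R := Normc.normc w.

Definition expi (t : R) : C := (cos t +i* sin t)%C.

Definition analytic_on_disk (f : C -> C) : Prop :=
  forall z : C, in_disk z -> derivable (f : C^o -> C^o) z 1.

Definition cderiv (f : C -> C) : C -> C :=
  fun z => (f : C^o -> C^o)^`() z.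

Definition self_map (phi : C -> C) : Prop :=
  analytic_on_disk phi /\ forall z : C, in_disk z -> in_disk (phi z).

Definition Hp_normp (p : R) (g : C -> C) : \bar R :=
  ereal_sup [set ((((pi *+ 2)^-1)%R)%:E *
                 \int[lebesgue_measure]_(t in `[(0:R)%R, (pi *+ 2 : R)%R])
                     ((cmod (g ((r%:C)%C * expi t))) `^ p)%:E)%E
            | r in (`]0, 1[%classic : set R)].

Definition Hp (p : R) (g : C -> C) : Prop :=
  analytic_on_disk g /\ (Hp_normp p g < +oo)%E.

(* the H^p norm ||g||_{H^p} (meaningful for g in H^p) *)
Definition Hp_norm (p : R) (g : C -> C) : R := (fine (Hp_normp p g)) `^ p^-1.

Definition Sp (p : R) (f : C -> C) : Prop :=
  analytic_on_disk f /\ Hp p (cderiv f).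

Definition Sp_norm (p : R) (f : C -> C) : R := cmod (f 0) + Hp_norm p (cderiv f).

Definition Cop (phi : C -> C) (f : C -> C) : C -> C := fun z => f (phi z).
Definition Dop (phi : C -> C) (f : C -> C) : C -> C := fun z => cderiv f (phi z).
Definition DCop (phi : C -> C) (f : C -> C) : C -> C := cderiv (fun z => f (phi z)).

(* T : X -> Y is compact: T maps X into Y, and the image of every bounded
   sequence of X has a subsequence converging in Y (i.e. T maps bounded sets
   to relatively compact sets of the Banach space Y). *)
Definition compact_op (inX : (C -> C) -> Prop) (normX : (C -> C) -> R)
    (inY : (C -> C) -> Prop) (normY : (C -> C) -> R)
    (T : (C -> C) -> (C -> C)) : Prop :=
  (forall f, inX f -> inY (T f)) /\
  forall u : nat -> (C -> C),
    (forall n, inX (u n)) ->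
    (exists M : R, forall n, normX (u n) <= M) ->
    exists s : nat -> nat,
      {homo s : m n / (m < n)%N >-> (m < n)%N} /\
      exists g, inY g /\
        (fun k => normY (T (u (s k)) \- g)) @ \oo --> (0 : R).

End HardyDefs.

(* Main.v *)
Require Import Defs.
From HB Require Import structures.
From mathcomp Require Import all_boot all_order all_algebra.
From mathcomp Require Import all_classical all_reals all_analysis.
From mathcomp Require Import complex.
From mathcomp Require Import measurable_realfun ring lra.
Import Order.TTheory GRing.Theory Num.Theory.
Import numFieldNormedType.Exports.
Local Open Scope ring_scope.

(** Differentiation turns S^p modulo constants into H^p, so the three operators
    are the same operator up to taking primitives. Since [D_phi F = C_phi F'],
    (i) and (ii) are equivalent as soon as every function of H^p has a primitive
    on the disk; analyticity is only pointwise complex differentiability, so this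
    is Goursat's theorem for triangles. (ii) implies (iii) by differentiating.
    For (iii) => (ii), a limit in H^p of [(u_n o phi)'] is integrated, and the
    constants [u_n (phi 0)] converge along a further subsequence because point
    evaluations are bounded on H^p. The last fact follows from a form of Cauchy's
    formula: if [F' = f], [zeta(t) = r e^(it) - w],
    [J(s) = int f(w + s zeta) zeta'/zeta dt] and
    [K(s) = int F(w + s zeta) zeta'/zeta^2 dt], then integrating by parts gives
    [K(s) = s J(s)] while [K' = J], hence [J' = 0] and
    [int f(r e^(it)) zeta'/zeta dt = J(1) = J(0) = f(w) int zeta'/zeta dt]. *)

Set Implicit Arguments.
Unset Strict Implicit.
Unset Printing Implicit Defensive.

Local Notation Re := complex.Re.
Local Notation Im := complex.Im.

(** * Real-valued modulus, real and imaginary parts *)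

Section ComplexModulus.
Variable R : realType.
Local Notation C := (complex R).
Implicit Types (x : R) (z w : C).

Lemma normCE z : `|z| = (cmod z)%:C%C. Proof. by case: z. Qed.

(** The norm on [complex R] takes values in [complex R], so [in_disk] compares in the partial order
    there; both sides are real, which brings the comparison down to [R]. *)
Lemma in_diskE z : in_disk z = (cmod z < 1) :> Prop.
Proof. by rewrite /in_disk normCE -[1]/(1%:C%C) ltcR. Qed.

Lemma cmod_ge0 z : 0 <= cmod z.
Proof. by rewrite -lecR -normCE; exact: normr_ge0. Qed.

Lemma cmodM z w : cmod (z * w) = cmod z * cmod w.
Proof. exact: Normc.normcM. Qed.

Lemma cmodV z : cmod z^-1 = (cmod z)^-1.
Proof. exact: Normc.normcV. Qed.

Lemma cmodN z : cmod (- z) = cmod z.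
Proof. by rewrite -mulN1r cmodM /cmod /= oppr0 expr0n /= addr0 sqrrN expr1n sqrtr1 mul1r. Qed.

Lemma cmodB z w : cmod (z - w) = cmod (w - z).
Proof. by rewrite -cmodN opprB. Qed.

Lemma cmodD z w : cmod (z + w) <= cmod z + cmod w.
Proof. by rewrite -lecR rmorphD /= -!normCE; exact: ler_normD. Qed.

Lemma cmod0 : cmod (0 : C) = 0. Proof. exact: Normc.normc0. Qed.

Lemma cmod_eq0 z : (cmod z == 0) = (z == 0).
Proof.
by apply/eqP/eqP => [/Normc.eq0_normc//|->]; exact: cmod0.
Qed.

Lemma cmod_gt0 z : (0 < cmod z) = (z != 0).
Proof. by rewrite lt_def cmod_ge0 andbT cmod_eq0. Qed.

Lemma cmodR x : cmod x%:C%C = `|x|.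
Proof. by rewrite /cmod /= expr0n /= addr0 sqrtr_sqr. Qed.

Lemma cmod_sqr z : cmod z ^+ 2 = Re z ^+ 2 + Im z ^+ 2.
Proof. by case: z => a b; rewrite /cmod /= sqr_sqrtr// addr_ge0// sqr_ge0. Qed.

Lemma Re_le_cmod z : `|Re z| <= cmod z.
Proof.
rewrite -(@ler_pXn2r _ 2) ?nnegrE ?normr_ge0 ?cmod_ge0//.
by rewrite cmod_sqr real_normK ?num_real// lerDl sqr_ge0.
Qed.

Lemma Im_le_cmod z : `|Im z| <= cmod z.
Proof.
rewrite -(@ler_pXn2r _ 2) ?nnegrE ?normr_ge0 ?cmod_ge0//.
by rewrite cmod_sqr real_normK ?num_real// lerDr sqr_ge0.
Qed.

Lemma cmod_le_ReIm z : cmod z <= `|Re z| + `|Im z|.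
Proof.
rewrite -(@ler_pXn2r _ 2) ?nnegrE ?addr_ge0 ?normr_ge0 ?cmod_ge0//.
rewrite cmod_sqr sqrrD !real_normK ?num_real// -addrA lerD2l lerDr.
by rewrite mulrn_wge0// mulr_ge0.
Qed.

Lemma ReD z w : Re (z + w) = Re z + Re w. Proof. by case: z; case: w. Qed.
Lemma ImD z w : Im (z + w) = Im z + Im w. Proof. by case: z; case: w. Qed.
Lemma ReN z : Re (- z) = - Re z. Proof. by case: z. Qed.
Lemma ImN z : Im (- z) = - Im z. Proof. by case: z. Qed.
Lemma ReMr z x : Re (z * x%:C%C) = Re z * x.
Proof. by case: z => a b /=; rewrite mulr0 subr0. Qed.
Lemma ImMr z x : Im (z * x%:C%C) = Im z * x.
Proof. by case: z => a b /=; rewrite mulr0 add0r. Qed.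
End ComplexModulus.

(** * First-order expansions of complex functions and of paths *)

Section Derivatives.
Local Open Scope classical_set_scope.

(** Multiplying the difference quotient by [h] removes the exclusion of [h = 0]. The field is kept
    general because the equivalence serves for [K = R] in [pderivP] and for [K = complex R] in
    [cdiffP]. *)
Lemma is_derive1_epsP (K : numFieldType) (f : K^o -> K^o) (z d : K) :
  is_derive (z : K^o) 1 f (d : K^o) <->
  forall e : K, 0 < e -> exists2 r : K, 0 < r &
    forall h, `|h| < r -> `|f (z + h) - f z - d * h| <= e * `|h|.
Proof.
split.
  move=> fd e e0.
  have cvgd : (fun h : K^o => h^-1 *: (f (h *: 1 + z) - f z)) @ 0^' --> (d : K^o).
    rewrite -(@derive_val _ _ _ _ _ _ _ fd); exact: (@ex_derive _ _ _ _ _ _ _ fd).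
  move/cvgrPdist_le : cvgd => /(_ e e0).
  move=> /nbhs_ballP[r /= r0 Hr].
  exists r => // h hr; have [->|h0] := eqVneq h 0.
    by rewrite addr0 subrr mulr0 subr0 normr0 mulr0.
  have /= := Hr h; rewrite /ball /= sub0r normrN => /(_ hr h0).
  rewrite distrC => H.
  have -> : f (z + h) - f z - d * h = h * (h^-1 *: (f (h *: (1:K^o) + z) - f z) - d).
    by rewrite /GRing.scale /= mulr1 (addrC h z) mulrBr mulVKf// (mulrC h d).
  by rewrite normrM mulrC ler_wpM2r.
move=> H.
have cvgd : (fun h : K^o => h^-1 *: (f (h *: 1 + z) - f z)) @ 0^' --> (d : K^o).
  apply/cvgrPdist_le => e e0; have [r r0 Hr] := H e e0.
  apply/nbhs_ballP; exists r => //= h.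
  rewrite /ball /= sub0r normrN => hr h0.
  rewrite distrC -(ler_pM2r (_ : 0 < `|h|)) ?normr_gt0// -normrM.
  apply: le_trans (Hr h hr); rewrite le_eqVlt; apply/orP; left; apply/eqP; congr (`|_|).
  by rewrite /GRing.scale /= mulr1 (addrC h z) mulrBl mulrAC mulVf// mul1r.
apply: DeriveDef.
  by apply/cvg_ex; exists d.
exact/cvg_lim.
Qed.

Variable R : realType.
Local Notation C := (complex R).

(** Complex differentiability with [e] and [r] taken in [R], so that all estimates take place in a
    totally ordered field. *)
Definition cdiff (f : C -> C) (z d : C) := forall e : R, 0 < e ->
  exists2 r : R, 0 < r & forall h : C, cmod h < r ->
    cmod (f (z + h) - f z - d * h) <= e * cmod h.

(* [complex R] is not a normed module over [R] in the library, so derivatives of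
   paths [R -> C] cannot be stated with [is_derive]. *)
Definition pderiv (f : R -> C) (t : R) (d : C) := forall e : R, 0 < e ->
  exists2 r : R, 0 < r & forall h : R, `|h| < r ->
    cmod (f (t + h) - f t - d * h%:C%C) <= e * `|h|.

Lemma cdiffP f z d : cdiff f z d <-> is_derive (z : C^o) 1 (f : C^o -> C^o) (d : C^o).
Proof.
split.
  move=> H; apply/is_derive1_epsP => e.
  (* Positivity in [complex R] forces the imaginary part of [e] to vanish. *)
  case: e => e1 e2; rewrite ltcE /= => /andP[/eqP-> e0].
  have [r r0 Hr] := H _ e0; exists r%:C%C; first by rewrite ltcR.
  move=> h; rewrite !normCE ltcR => /Hr.
  by rewrite -[(_ +i* _)%C]/(e1%:C)%C -rmorphM /= lecR.
move=> /is_derive1_epsP H e e0; have := H e%:C%C; rewrite ltcR => /(_ e0)[].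
case=> r1 r2; rewrite ltcE /= => /andP[/eqP-> r0] Hr.
exists r1 => // h hr; have := Hr h.
by rewrite !normCE -[(_ +i* _)%C]/(r1%:C)%C ltcR => /(_ hr); rewrite -rmorphM /= lecR.
Qed.

Lemma pderivP f t d : pderiv f t d <->
  is_derive (t : R^o) 1 (fun x => Re (f x) : R^o) (Re d : R^o) /\
  is_derive (t : R^o) 1 (fun x => Im (f x) : R^o) (Im d : R^o).
Proof.
split.
  move=> H; split; apply/is_derive1_epsP => e e0; have [r r0 Hr] := H e e0;
      exists r => // h hr; apply: le_trans (Hr h hr).
    by apply: le_trans (Re_le_cmod _); rewrite !(ReD,ReN,ReMr).
  by apply: le_trans (Im_le_cmod _); rewrite !(ImD,ImN,ImMr).
move=> [/is_derive1_epsP H1 /is_derive1_epsP H2] e e0.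
have e20 : 0 < e / 2 by rewrite divr_gt0.
have [r1 r10 Hr1] := H1 _ e20; have [r2 r20 Hr2] := H2 _ e20.
exists (Num.min r1 r2); first by rewrite lt_min r10.
move=> h; rewrite lt_min => /andP[/Hr1 h1 /Hr2 h2].
apply: le_trans (cmod_le_ReIm _) _; rewrite !(ReD,ReN,ReMr,ImD,ImN,ImMr).
by apply: le_trans (lerD h1 h2) _; rewrite -mulrDl -splitr.
Qed.

Lemma pderiv_comp f g t d d' : pderiv g t d -> cdiff f (g t) d' ->
  pderiv (f \o g) t (d' * d).
Proof.
move=> gd fd e e0.
have e1 : 0 < e / 2 / (cmod d + 1).
  by rewrite !divr_gt0// ltr_wpDl// cmod_ge0.
have [rf rf0 Hf] := fd _ e1.
(* The bound 1 yields [cmod k <= |h| (cmod d + 1)]; the other bound keeps the error [cmod d' * e2]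
   below [e / 2]. Adding 1 to the moduli keeps the denominators positive. *)
pose e2 := Num.min 1 (e / 2 / (cmod d' + 1)).
have e20 : 0 < e2 by rewrite lt_min ltr01 !divr_gt0// ltr_wpDl// cmod_ge0.
have [rg rg0 Hg] := gd _ e20.
exists (Num.min rg (rf / (cmod d + 1))).
  by rewrite lt_min rg0 divr_gt0// ltr_wpDl// cmod_ge0.
move=> h; rewrite lt_min => /andP[/Hg gh].
rewrite ltr_pdivlMr ?ltr_wpDl ?cmod_ge0// => hr.
set k := g (t + h) - g t in gh *.
have kh : cmod k <= `|h| * (cmod d + 1).
  rewrite -(subrK (d * h%:C%C) k); apply: le_trans (cmodD _ _) _.
  rewrite cmodM cmodR mulrDr mulr1 addrC mulrC lerD2l.
  by apply: le_trans gh _; rewrite ler_piMl// ge_min lexx.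
have := Hf k (le_lt_trans kh hr).
have -> : g t + k = g (t + h) by rewrite /k addrC subrK.
move=> fk /=.
have -> : f (g (t + h)) - f (g t) - d' * d * h%:C%C =
  (f (g (t + h)) - f (g t) - d' * k) + d' * (k - d * h%:C%C) by ring.
apply: le_trans (cmodD _ _) _; rewrite (splitr e) mulrDl lerD//.
  apply: le_trans fk _; apply: le_trans (ler_wpM2l (ltW e1) kh) _.
  by rewrite mulrCA divfK ?gt_eqF ?ltr_wpDl ?cmod_ge0// mulrC.
rewrite cmodM; apply: le_trans (ler_wpM2l (cmod_ge0 _) gh) _.
rewrite mulrA ler_wpM2r//.
apply: (@le_trans _ _ ((cmod d' + 1) * e2)); first by rewrite ler_wpM2r ?(ltW e20)// lerDl.
by rewrite mulrC -ler_pdivlMr ?ltr_wpDl ?cmod_ge0// ge_min lexx orbT.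
Qed.

End Derivatives.

(** * Path integrals *)

Section PathIntegral.
Local Open Scope classical_set_scope.
Variable R : realType.
Local Notation C := (complex R).
Local Notation mu := (@lebesgue_measure R).

(** Clamping the argument to [[a, b]] extends [h] continuously to the whole line. Integrating the
    extension from [a - 1] makes the derivative two-sided at [a] and [b] as well. *)
Lemma continuous_primitive (h : R -> R) (a b : R) : a <= b ->
  (forall t, a <= t <= b -> {for t, continuous h}) ->
  exists H : R -> R, forall t, a <= t <= b -> is_derive t 1 H (h t).
Proof.
move=> ab hc.
pose g x := h (Num.max a (Num.min b x)).
have gc : continuous g.
  move=> x; apply: (@continuous_comp _ _ _ (fun x => Num.max a (Num.min b x)) h).
    by apply: continuous_max; [exact: cvg_cst|apply: continuous_min; [exact: cvg_cst|exact: cvg_id]].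
  by apply: hc; rewrite le_max lexx /= ge_max ab ge_min lexx.
exists (fun x => \int[mu]_(t in [set` `[a - 1, x]]) g t)%R.
move=> t /andP[at_ tb].
have gi : mu.-integrable `[a - 1, b + 1] (EFin \o g).
  by apply: continuous_compact_integrable; [exact: segment_compact|exact: continuous_subspaceT].
have [|||d1 d2] := @continuous_FTC1_closed R g (a - 1) t (b + 1) _ gi.
- by lra.
- by lra.
- exact: gc.
apply: DeriveDef => //.
rewrite -derive1E d2 /g; congr h.
by rewrite min_r// max_r.
Qed.

Definition cint (a b : R) (h : R -> C) : C :=
  ((\int[mu]_(t in `[a, b]) Re (h t))%R +i* (\int[mu]_(t in `[a, b]) Im (h t))%R)%C.

Lemma is_derive_continuous (h : R -> R) (t d : R) : is_derive t 1 h d -> {for t, continuous h}.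
Proof.
by move=> hd; apply/differentiable_continuous/derivable1_diffP; exact: ex_derive.
Qed.

Lemma pderiv_Re (h : R -> C) t d : pderiv h t d -> is_derive t 1 (fun x => Re (h x)) (Re d).
Proof. by move=> /pderivP[]. Qed.

Lemma pderiv_Im (h : R -> C) t d : pderiv h t d -> is_derive t 1 (fun x => Im (h x)) (Im d).
Proof. by move=> /pderivP[]. Qed.

(** The regularity carried along for integrands. All of them compose complex differentiable
    functions with smooth paths, so it is always at hand and gives continuity of both components. *)
Definition pderivable_on (a b : R) (h : R -> C) :=
  forall t, a <= t <= b -> exists d, pderiv h t d.

Lemma pderivable_Re a b h t : pderivable_on a b h -> a <= t <= b ->
  {for t, continuous (fun x => Re (h x))}.
Proof. by move=> hd /hd[d /pderiv_Re]; exact: is_derive_continuous. Qed.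

Lemma pderivable_Im a b h t : pderivable_on a b h -> a <= t <= b ->
  {for t, continuous (fun x => Im (h x))}.
Proof. by move=> hd /hd[d /pderiv_Im]; exact: is_derive_continuous. Qed.

Lemma for_within_continuous (a b : R) (h : R -> R) :
  (forall t, a <= t <= b -> {for t, continuous h}) -> {within `[a, b], continuous h}.
Proof.
move=> hc; apply: continuous_in_subspaceT => t.
by rewrite inE /= in_itv /=; exact: hc.
Qed.

Lemma Rintegral_FTC (a b : R) (h H : R -> R) : a < b ->
  (forall t, a <= t <= b -> {for t, continuous h}) ->
  (forall t, a <= t <= b -> is_derive t 1 H (h t)) ->
  (\int[mu]_(t in `[a, b]) h t)%R = H b - H a.
Proof.
move=> ab hc hd.
have Hc t : a <= t <= b -> {for t, continuous H} by move/hd; exact: is_derive_continuous.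
rewrite /Rintegral (@continuous_FTC2 R h H a b) //=.
- exact: for_within_continuous.
- have [_ H1 H2] := (continuous_within_itvP H ab).1 (for_within_continuous Hc).
  split=> // t; rewrite in_itv /= => /andP[at_ tb].
  by have := hd t; rewrite !ltW// => /(_ isT) [].
- move=> t; rewrite in_itv /= => /andP[at_ tb].
  by have := hd t; rewrite !ltW// => /(_ isT) hdt; rewrite derive1E; exact: derive_val.
Qed.

Lemma cint_FTC (a b : R) (h H : R -> C) : a < b -> pderivable_on a b h ->
  (forall t, a <= t <= b -> pderiv H t (h t)) -> cint a b h = H b - H a.
Proof.
move=> ab hd Hd; rewrite /cint.
have -> := @Rintegral_FTC a b (fun x => Re (h x)) (fun x => Re (H x)) ab
  (fun t => @pderivable_Re a b h t hd) (fun t tab => pderiv_Re (Hd t tab)).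
have -> := @Rintegral_FTC a b (fun x => Im (h x)) (fun x => Im (H x)) ab
  (fun t => @pderivable_Im a b h t hd) (fun t tab => pderiv_Im (Hd t tab)).
by case: (H a) (H b) => [? ?] [? ?].
Qed.

Lemma pderivable_primitive (a b : R) (h : R -> C) : a <= b -> pderivable_on a b h ->
  exists H : R -> C, forall t, a <= t <= b -> pderiv H t (h t).
Proof.
move=> ab hd.
have [H1 dH1] := continuous_primitive ab (fun t => @pderivable_Re a b h t hd).
have [H2 dH2] := continuous_primitive ab (fun t => @pderivable_Im a b h t hd).
by exists (fun t => (H1 t +i* H2 t)%C) => t tab; apply/pderivP; split; [exact: dH1|exact: dH2].
Qed.

(* The factor 2 comes from bounding real and imaginary parts separately. *)
Lemma mean_value_bound (a b M : R) (h H : R -> C) : a <= b ->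
  (forall t, a <= t <= b -> pderiv H t (h t)) ->
  (forall t, a <= t <= b -> cmod (h t) <= M) ->
  cmod (H b - H a) <= 2 * M * (b - a).
Proof.
move=> ab Hd hM.
have oc t : t \in `]a, b[%R -> a <= t <= b by rewrite in_itv /= => /andP[/ltW-> /ltW->].
have [||c] := @MVT_segment R (fun x => Re (H x)) (fun x => Re (h x)) a b ab.
- by move=> t /oc /Hd /pderiv_Re.
- by apply: for_within_continuous => t /Hd /pderiv_Re; exact: is_derive_continuous.
rewrite in_itv /= => /hM cM Hc.
have [||d] := @MVT_segment R (fun x => Im (H x)) (fun x => Im (h x)) a b ab.
- by move=> t /oc /Hd /pderiv_Im.
- by apply: for_within_continuous => t /Hd /pderiv_Im; exact: is_derive_continuous.
rewrite in_itv /= => /hM dM Hdd.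
apply: le_trans (cmod_le_ReIm _) _; rewrite !(ReD, ImD, ReN, ImN) Hc Hdd.
rewrite !normrM (ger0_norm (_ : 0 <= b - a)) ?subr_ge0// -mulrDl.
rewrite ler_wpM2r ?subr_ge0// (mulr_natl M) mulr2n lerD//.
  exact: le_trans (Re_le_cmod _) cM.
exact: le_trans (Im_le_cmod _) dM.
Qed.

Lemma pderivB (f g : R -> C) t d e : pderiv f t d -> pderiv g t e ->
  pderiv (fun x => f x - g x) t (d - e).
Proof.
move=> /pderivP[f1 f2] /pderivP[g1 g2]; apply/pderivP; split.
  have -> : (fun x => Re (f x - g x)) = (fun x => Re (f x)) - (fun x => Re (g x)).
    by apply/funext => x; rewrite ReD ReN.
  by rewrite ReD ReN; exact: is_deriveB.
have -> : (fun x => Im (f x - g x)) = (fun x => Im (f x)) - (fun x => Im (g x)).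
  by apply/funext => x; rewrite ImD ImN.
by rewrite ImD ImN; exact: is_deriveB.
Qed.

(** Applied to primitives, this takes the place of a change of variables in integrals: it reverses
    and halves segments. *)
Lemma pderiv_affine_repar (f : R -> C) (u v t : R) d : pderiv f (u + v * t) d ->
  pderiv (fun x => f (u + v * x)) t (d * v%:C%C).
Proof.
move=> fd e e0.
have v0 : 0 < `|v| + 1 by rewrite ltr_wpDl.
have e1 : 0 < e / (`|v| + 1) by rewrite divr_gt0.
have [r r0 Hr] := fd _ e1; exists (r / (`|v| + 1)); first by rewrite divr_gt0.
move=> h hr; have vh : `|v * h| < r.
  rewrite normrM; apply: (@le_lt_trans _ _ (`|h| * (`|v| + 1))); last by rewrite -ltr_pdivlMr.
  by rewrite mulrC ler_wpM2l// lerDl.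
have := Hr _ vh; rewrite mulrDr addrA rmorphM /= mulrA => /le_trans; apply.
rewrite normrM mulrA ler_wpM2r// mulrAC ler_pdivrMr// ler_wpM2l ?(ltW e0)//.
by rewrite lerDl.
Qed.

(** Each component is at most the integral of the modulus, whence the factor 2; any constant
    suffices for bounding point evaluations. *)
Lemma cmod_cint (a b : R) (h : R -> C) : pderivable_on a b h ->
  {within `[a, b], continuous (fun t => cmod (h t))} ->
  cmod (cint a b h) <= 2 * (\int[mu]_(t in `[a, b]) cmod (h t))%R.
Proof.
move=> hd hc.
have bnd (g : R -> R) : (forall t, a <= t <= b -> {for t, continuous g}) ->
    (forall t, `|g t| <= cmod (h t)) ->
    `|(\int[mu]_(t in `[a, b]) g t)%R| <= (\int[mu]_(t in `[a, b]) cmod (h t))%R.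
  move=> gc gh.
  have gi : mu.-integrable `[a, b] (EFin \o g).
    by apply: continuous_compact_integrable; [exact: segment_compact|exact: for_within_continuous].
  have hi : mu.-integrable `[a, b] (EFin \o (fun t => cmod (h t))).
    by apply: continuous_compact_integrable; [exact: segment_compact|].
  apply: le_trans (le_normr_Rintegral _ gi) _ => //.
  apply: le_Rintegral => //.
  exact: integrable_norm.
apply: le_trans (cmod_le_ReIm _) _; rewrite mulr_natl mulr2n; apply: lerD.
  by apply: bnd => [t|t]; [exact: pderivable_Re|exact: Re_le_cmod].
by apply: bnd => [t|t]; [exact: pderivable_Im|exact: Im_le_cmod].
Qed.

End PathIntegral.

(** * Goursat's theorem *)

Section TriangleIntegrals.
Local Open Scope classical_set_scope.
Variable R : realType.
Local Notation C := (complex R).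

Lemma cdiff_cstM (f : C -> C) c z d : cdiff f z d -> cdiff (fun x => f x * c) z (d * c).
Proof.
move=> fd e e0; have c1 : 0 < cmod c + 1 by rewrite ltr_wpDl ?cmod_ge0.
have [r r0 Hr] := fd _ (divr_gt0 e0 c1); exists r => // h /Hr H.
have -> : f (z + h) * c - f z * c - d * c * h = c * (f (z + h) - f z - d * h) by ring.
rewrite cmodM; apply: le_trans (ler_wpM2l (cmod_ge0 _) H) _.
rewrite mulrA ler_wpM2r ?cmod_ge0// mulrCA ger_pMr// ler_pdivrMr// mul1r.
by rewrite lerDl.
Qed.

Definition seg (a b : C) (t : R) : C := a + (b - a) * t%:C%C.

(** Convexity of disks: [seg a b t - l] is a convex combination of [a - l] and [b - l]. *)
Lemma seg_ball (l a b : C) m t : cmod (a - l) <= m -> cmod (b - l) <= m -> 0 <= t <= 1 ->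
  cmod (seg a b t - l) <= m.
Proof.
move=> am bm /andP[t0 t1].
have -> : seg a b t - l = (a - l) * (1 - t)%:C%C + (b - l) * t%:C%C.
  by rewrite /seg rmorphB rmorph1; ring.
apply: le_trans (cmodD _ _) _; rewrite !cmodM !cmodR !ger0_norm ?subr_ge0//.
have -> : m = m * (1 - t) + m * t by ring.
by apply: lerD; rewrite ler_wpM2r ?subr_ge0.
Qed.

Lemma seg_disk (a b : C) t : cmod a < 1 -> cmod b < 1 -> 0 <= t <= 1 ->
  cmod (seg a b t) < 1.
Proof.
move=> a1 b1 t01; apply: (@le_lt_trans _ _ (Num.max (cmod a) (cmod b))).
  by rewrite -(subr0 (seg a b t)) seg_ball// subr0 le_max lexx ?orbT.
by rewrite gt_max a1.
Qed.

Lemma pderiv_seg a b t : pderiv (seg a b) t (b - a).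
Proof.
move=> e e0; exists 1 => // h _; rewrite /seg rmorphD /=.
have -> : a + (b - a) * (t%:C%C + h%:C%C) - (a + (b - a) * t%:C%C) - (b - a) * h%:C%C = 0 by ring.
by rewrite cmod0 mulr_ge0// ltW.
Qed.

(** One subsequence makes the real parts converge, and a further one the imaginary parts. *)
Lemma bolzano_weierstrass_complex (u : nat -> C) (M : R) : (forall n, cmod (u n) <= M) ->
  exists2 s : nat -> nat, {homo s : m n / (m < n)%N >-> (m < n)%N} &
  exists l : C, forall e, 0 < e -> exists N, forall n, (N <= n)%N -> cmod (u (s n) - l) < e.
Proof.
move=> uM.
have bnd (v : nat -> R) : (forall n, `|v n| <= M) -> bounded_fun v.
  move=> vM; exists M; split; first exact: num_real.
  by move=> x Mx n _ /=; apply: le_trans (vM n) (ltW Mx).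
have [s1 s1i /cvg_ex[/= l1 s1l]] := bolzano_weierstrass (bnd (fun n => Re (u n))
  (fun n => le_trans (Re_le_cmod _) (uM n))).
have [s2 s2i /cvg_ex[/= l2 s2l]] := bolzano_weierstrass (bnd (fun n => Im (u (s1 n)))
  (fun n => le_trans (Im_le_cmod _) (uM _))).
have inc s : increasing_seq s -> {homo s : m n / (m < n)%N >-> (m < n)%N}.
  by move=> si m n mn; rewrite !ltnNge; have := si n m; rewrite !leEnat => ->; rewrite -ltnNge.
exists (s1 \o s2).
  by move=> m n mn /=; apply: (inc s1) => //; exact: (inc s2).
exists (l1 +i* l2)%C => e e0.
have e20 : 0 < e / 2 by rewrite divr_gt0.
move/cvgrPdist_lt : s1l => /(_ _ e20)[N1 _ HN1].
move/cvgrPdist_lt : s2l => /(_ _ e20)[N2 _ HN2].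
have s2n n : (n <= s2 n)%N.
  by elim: n => // n IH; apply: leq_ltn_trans IH _; exact: (inc s2).
exists (maxn N1 N2) => n; rewrite geq_max => /andP[n1 n2].
apply: le_lt_trans (cmod_le_ReIm _) _; rewrite !(ReD,ImD,ReN,ImN) /= (splitr e).
rewrite distrC (distrC _ l2); apply: ltrD; last exact: HN2.
by apply: HN1 => /=; exact: leq_trans n1 (s2n n).
Qed.

Variable f : C -> C.
Hypothesis fD : forall z, cmod z < 1 -> exists d, cdiff f z d.

Definition segint (a b : C) : C := cint 0 1 (fun t => f (seg a b t) * (b - a)).

Lemma pderivable_seg a b : cmod a < 1 -> cmod b < 1 ->
  pderivable_on 0 1 (fun t => f (seg a b t) * (b - a)).
Proof.
move=> a1 b1 t t01; have [d fd] := fD (seg_disk a1 b1 t01).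
exists (d * (b - a) * (b - a)).
exact: (pderiv_comp (pderiv_seg a b t) (cdiff_cstM (b - a) fd)).
Qed.

Lemma segint_eq a b H : cmod a < 1 -> cmod b < 1 ->
  (forall t, 0 <= t <= 1 -> pderiv H t (f (seg a b t) * (b - a))) ->
  segint a b = H 1 - H 0.
Proof. by move=> a1 b1; apply: cint_FTC => //; exact: pderivable_seg. Qed.

(** Continuity along the segment gives a primitive in the real parameter, without any complex
    primitive of [f]. Reversal and bisection of segments then become reparametrisations of [H]. *)
Lemma seg_primitive a b : cmod a < 1 -> cmod b < 1 -> exists H,
  (forall t, 0 <= t <= 1 -> pderiv H t (f (seg a b t) * (b - a))).
Proof. by move=> a1 b1; apply: pderivable_primitive => //; exact: pderivable_seg. Qed.

Lemma segint_sym a b : cmod a < 1 -> cmod b < 1 -> segint b a = - segint a b.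
Proof.
move=> a1 b1; have [H Hd] := seg_primitive a1 b1.
rewrite (segint_eq a1 b1 Hd) opprB.
rewrite (@segint_eq b a (fun t => H (1 + (-1) * t)))//.
  by rewrite mulr1 mulr0 addr0 subrr.
move=> t t01; have -> : f (seg b a t) * (a - b) = f (seg a b (1 + -1 * t)) * (b - a) * (-1)%:C%C.
  have -> : seg b a t = seg a b (1 + -1 * t).
    by rewrite /seg !(rmorphD, rmorphN, rmorphM, rmorph1) /=; ring.
  by rewrite rmorphN rmorph1; ring.
by apply: pderiv_affine_repar; apply: Hd; lra.
Qed.

Definition mid (a b : C) := seg a b 2^-1.

Lemma segint_mid a b : cmod a < 1 -> cmod b < 1 ->
  segint a b = segint a (mid a b) + segint (mid a b) b.
Proof.
move=> a1 b1; have [H Hd] := seg_primitive a1 b1.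
have m1 : cmod (mid a b) < 1 by apply: seg_disk => //; lra.
have half : (2^-1)%:C%C = 2^-1 :> C by rewrite fmorphV rmorph_nat.
rewrite (segint_eq a1 b1 Hd).
rewrite (@segint_eq a (mid a b) (fun t => H (0 + 2^-1 * t)))//; last first.
  move=> t t01; have -> : f (seg a (mid a b) t) * (mid a b - a) =
      f (seg a b (0 + 2^-1 * t)) * (b - a) * (2^-1)%:C%C.
    have -> : seg a (mid a b) t = seg a b (0 + 2^-1 * t).
      by rewrite /mid /seg !(rmorphD, rmorphM, rmorph0) /= half; field.
    by rewrite /mid /seg half; field.
  by apply: pderiv_affine_repar; apply: Hd; lra.
rewrite (@segint_eq (mid a b) b (fun t => H (2^-1 + 2^-1 * t)))//; last first.
  move=> t t01; have -> : f (seg (mid a b) b t) * (b - mid a b) =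
      f (seg a b (2^-1 + 2^-1 * t)) * (b - a) * (2^-1)%:C%C.
    have -> : seg (mid a b) b t = seg a b (2^-1 + 2^-1 * t).
      by rewrite /mid /seg !(rmorphD, rmorphM, rmorph0) /= half; field.
    by rewrite /mid /seg half; field.
  by apply: pderiv_affine_repar; apply: Hd; lra.
by rewrite !mulr1 !mulr0 !addr0 add0r (_ : 2^-1 + 2^-1 = 1 :> R); [ring|field].
Qed.

(** The integral of [q] is [Q b - Q a] because [Q] is a primitive; the mean value bound applies to
    [H - Q] along the segment, whose derivative is small. *)
Lemma segint_approx (Q q : C -> C) a b M : cmod a < 1 -> cmod b < 1 ->
  (forall z, cdiff Q z (q z)) ->
  (forall t, 0 <= t <= 1 -> cmod (f (seg a b t) - q (seg a b t)) <= M) ->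
  cmod (segint a b - (Q b - Q a)) <= 2 * M * cmod (b - a).
Proof.
move=> a1 b1 Qd fM; have [H Hd] := seg_primitive a1 b1.
rewrite (segint_eq a1 b1 Hd).
have Gd t : 0 <= t <= 1 -> pderiv (fun x => H x - Q (seg a b x)) t
    (f (seg a b t) * (b - a) - q (seg a b t) * (b - a)).
  move=> t01; apply: pderivB; first exact: Hd.
  exact: (pderiv_comp (pderiv_seg a b t) (Qd _)).
have := @mean_value_bound R 0 1 (M * cmod (b - a)) _ _ ler01 Gd.
rewrite subr0 mulr1 mulrA.
have -> : H 1 - Q (seg a b 1) - (H 0 - Q (seg a b 0)) = H 1 - H 0 - (Q b - Q a).
  have -> : seg a b 1 = b by rewrite /seg rmorph1; ring.
  have -> : seg a b 0 = a by rewrite /seg rmorph0; ring.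
  by ring.
by apply => t t01; rewrite -mulrBl cmodM ler_wpM2r ?cmod_ge0// fM.
Qed.

Definition tri (a b c : C) := segint a b + segint b c + segint c a.

(** Each side of the medial triangle is run through twice in opposite directions, so the inner
    contributions cancel. *)
Lemma tri_split a b c : cmod a < 1 -> cmod b < 1 -> cmod c < 1 ->
  tri a b c = tri a (mid a b) (mid c a) + tri (mid a b) b (mid b c) +
    tri (mid c a) (mid b c) c + tri (mid a b) (mid b c) (mid c a).
Proof.
move=> a1 b1 c1; rewrite /tri.
have m1 x y : cmod x < 1 -> cmod y < 1 -> cmod (mid x y) < 1.
  by move=> ? ?; apply: seg_disk => //; lra.
rewrite (segint_mid a1 b1) (segint_mid b1 c1) (segint_mid c1 a1).
have ab := m1 _ _ a1 b1; have bc := m1 _ _ b1 c1; have ca := m1 _ _ c1 a1.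
rewrite (segint_sym ca ab) (segint_sym ab bc) (segint_sym bc ca).
by ring.
Qed.

Definition perim (a b c : C) := cmod (a - b) + cmod (b - c) + cmod (c - a).

Definition tri_le (m : R) (T : C * C * C) :=
  [/\ cmod T.1.1 <= m, cmod T.1.2 <= m & cmod T.2 <= m].

(** What one bisection preserves. The first vertex stands for the triangle: its displacement bound
    makes these vertices a Cauchy sequence, and the last clause keeps all triangles in one closed
    disk. *)
Definition tri_step (T T' : C * C * C) :=
  [/\ perim T'.1.1 T'.1.2 T'.2 = perim T.1.1 T.1.2 T.2 / 2,
      cmod (T'.1.1 - T.1.1) <= perim T.1.1 T.1.2 T.2 / 2,
      cmod (tri T.1.1 T.1.2 T.2) <= 4 * cmod (tri T'.1.1 T'.1.2 T'.2) &
      forall m, tri_le m T -> tri_le m T'].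

Lemma mid_le m a b : cmod a <= m -> cmod b <= m -> cmod (mid a b) <= m.
Proof.
move=> am bm; rewrite -(subr0 (mid a b)); apply: seg_ball; rewrite ?subr0//; lra.
Qed.

Lemma cmod_half (z : C) : cmod (z / 2) = cmod z / 2.
Proof.
rewrite cmodM cmodV; congr (_ / _).
by rewrite -[LHS]/(cmod (2%:R)) -(rmorph_nat (real_complex R)) cmodR ger0_norm.
Qed.

Lemma tri_stepP T m : m < 1 -> tri_le m T -> exists T', tri_step T T'.
Proof.
case: T => [[a b] c] mlt [/= am bm cm].
have half : (2^-1)%:C%C = 2^-1 :> C by rewrite fmorphV rmorph_nat.
have midE x y : mid x y = (x + y) / 2 by rewrite /mid /seg half; field.
have split4 := tri_split (le_lt_trans am mlt) (le_lt_trans bm mlt) (le_lt_trans cm mlt).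
have p0 (x y : C) : 0 <= cmod (x - y) by exact: cmod_ge0.
(* Sides of the four small triangles are halves of the original sides; [hd'] covers the opposite
   orientation. *)
have hd (x y w w' : C) : x - y = (w - w') / 2 -> cmod (x - y) = cmod (w - w') / 2.
  by move=> ->; exact: cmod_half.
have hd' (x y w w' : C) : x - y = (w - w') / 2 -> cmod (x - y) = cmod (w' - w) / 2.
  by move=> /hd ->; rewrite cmodB.
have [h1|h1] := leP (cmod (tri a b c)) (4 * cmod (tri a (mid a b) (mid c a))).
  exists (a, mid a b, mid c a); split => //=; last first.
  - by move=> k [/= ? ? ?]; split => //=; exact: mid_le.
  - by rewrite subrr cmod0 divr_ge0// !addr_ge0.
  rewrite /perim (hd a (mid a b) a b) ?(hd (mid a b) (mid c a) b c) ?(hd (mid c a) a c a); try by rewrite !midE; field.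
  by rewrite -!mulrDl.
have [h2|h2] := leP (cmod (tri a b c)) (4 * cmod (tri (mid a b) b (mid b c))).
  exists (mid a b, b, mid b c); split => //=; last first.
  - by move=> k [/= ? ? ?]; split => //=; exact: mid_le.
  - rewrite (hd' (mid a b) a b a) ?midE; last by field.
    by rewrite ler_pM2r// /perim -addrA lerDl addr_ge0.
  rewrite /perim (hd (mid a b) b a b) ?(hd b (mid b c) b c) ?(hd (mid b c) (mid a b) c a); try by rewrite !midE; field.
  by rewrite -!mulrDl.
have [h3|h3] := leP (cmod (tri a b c)) (4 * cmod (tri (mid c a) (mid b c) c)).
  exists (mid c a, mid b c, c); split => //=; last first.
  - by move=> k [/= ? ? ?]; split => //=; exact: mid_le.
  - rewrite (hd (mid c a) a c a) ?midE; last by field.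
    by rewrite ler_pM2r// /perim lerDr addr_ge0.
  rewrite /perim (hd (mid c a) (mid b c) a b) ?(hd (mid b c) c b c) ?(hd c (mid c a) c a); try by rewrite !midE; field.
  by rewrite -!mulrDl.
(* Otherwise all four integrals would be smaller than a quarter of the whole, against the triangle
   inequality applied to [split4]. *)
have h4 : cmod (tri a b c) <= 4 * cmod (tri (mid a b) (mid b c) (mid c a)).
  rewrite leNgt; apply/negP => h4.
  have : cmod (tri a b c) <= cmod (tri a (mid a b) (mid c a)) + cmod (tri (mid a b) b (mid b c)) +
    cmod (tri (mid c a) (mid b c) c) + cmod (tri (mid a b) (mid b c) (mid c a)).
    rewrite {1}split4; apply: le_trans (cmodD _ _) _; rewrite lerD2r.
    by apply: le_trans (cmodD _ _) _; rewrite lerD2r; exact: cmodD.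
  by lra.
exists (mid a b, mid b c, mid c a); split => //=; last first.
- by move=> k [/= ? ? ?]; split => //=; exact: mid_le.
- rewrite (hd' (mid a b) a b a) ?midE; last by field.
  by rewrite ler_pM2r// /perim -addrA lerDl addr_ge0.
rewrite /perim (hd' (mid a b) (mid b c) a c) ?(hd' (mid b c) (mid c a) b a) ?(hd' (mid c a) (mid a b) c b); try by rewrite !midE; field.
by rewrite -!mulrDl; congr (_ / 2); ring.
Qed.

End TriangleIntegrals.

(** * Vanishing of triangle integrals, and primitives on the disk *)

Section Goursat.
Local Open Scope classical_set_scope.
Variable R : realType.
Local Notation C := (complex R).
Variable f : C -> C.
Hypothesis fD : forall z, cmod z < 1 -> exists d, cdiff f z d.

(** The remainder is exactly [v / 2 * h * h]. This primitive of an affine function is used for the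
    linear approximation of [f], and with [v = 0] for constant approximation. *)
Lemma cdiff_quadratic (u v l z : C) :
  cdiff (fun x => u * x + v * ((x - l) * (x - l) / 2)) z (u + v * (z - l)).
Proof.
move=> e e0; have v1 : 0 < cmod v + 1 by rewrite ltr_wpDl ?cmod_ge0.
exists (e / (cmod v + 1)); first by rewrite divr_gt0.
move=> h hr.
have -> : u * (z + h) + v * ((z + h - l) * (z + h - l) / 2) -
  (u * z + v * ((z - l) * (z - l) / 2)) - (u + v * (z - l)) * h = v / 2 * h * h by field.
rewrite cmodM ler_wpM2r ?cmod_ge0// cmodM cmod_half.
move: hr; rewrite ltr_pdivlMr// => /ltW; apply: le_trans.
rewrite mulrC ler_wpM2l ?cmod_ge0//.
have := cmod_ge0 v; lra.
Qed.

(** The affine part of [f] at [l] has the primitive [Q], whose increments cancel around the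
    triangle; only the remainder, at most [e * r], contributes on each side. *)
Lemma tri_approx (l d : C) (e r : R) a b c : 0 <= e ->
  cmod a < 1 -> cmod b < 1 -> cmod c < 1 ->
  cmod (a - l) <= r -> cmod (b - l) <= r -> cmod (c - l) <= r ->
  (forall h : C, cmod h <= r -> cmod (f (l + h) - f l - d * h) <= e * cmod h) ->
  cmod (tri f a b c) <= 2 * e * r * perim a b c.
Proof.
move=> e0 a1 b1 c1 al bl cl fl.
pose Q x := f l * x + d * ((x - l) * (x - l) / 2).
have side x y : cmod x < 1 -> cmod y < 1 -> cmod (x - l) <= r -> cmod (y - l) <= r ->
    cmod (segint f x y - (Q y - Q x)) <= 2 * (e * r) * cmod (x - y).
  move=> x1 y1 xl yl; rewrite (cmodB x).
  apply: (@segint_approx R f fD Q (fun z => f l + d * (z - l))) => //.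
    by move=> z; exact: cdiff_quadratic.
  move=> t t01; have sl := seg_ball xl yl t01.
  have := fl _ sl; rewrite addrCA subrr addr0 -addrA -opprD => /le_trans; apply.
  by rewrite ler_wpM2l.
have -> : tri f a b c = (segint f a b - (Q b - Q a)) + (segint f b c - (Q c - Q b)) +
   (segint f c a - (Q a - Q c)) by rewrite /tri; ring.
apply: le_trans (cmodD _ _) _; apply: le_trans (lerD (cmodD _ _) (lexx _)) _.
rewrite /perim -(mulrA 2) !mulrDr; apply: lerD; [apply: lerD|]; exact: side.
Qed.

Lemma goursat a b c : cmod a < 1 -> cmod b < 1 -> cmod c < 1 -> tri f a b c = 0.
Proof.
move=> a1 b1 c1.
(* All triangles stay in the closed disk of radius [m < 1], which keeps the limit point inside the
   open disk. *)
pose m := Num.max (cmod a) (Num.max (cmod b) (cmod c)).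
have mlt : m < 1 by rewrite !gt_max a1 b1 c1.
have T0m : tri_le m (a, b, c) by split; rewrite /= !le_max lexx ?orbT.
have /choice[nxt Hn] : forall T, exists T', tri_le m T -> tri_step f T T'.
  move=> T; have [Tm|nTm] := pselect (tri_le m T); last by exists T.
  by have [T' ?] := tri_stepP fD mlt Tm; exists T'.
pose T n := iter n nxt (a, b, c).
pose A n := (T n).1.1.
pose p n := perim (T n).1.1 (T n).1.2 (T n).2.
pose I n := cmod (tri f (T n).1.1 (T n).1.2 (T n).2).
have Tm n : tri_le m (T n) by elim: n => [//|n IH]; have [_ _ _] := Hn _ IH; apply.
have step n : tri_step f (T n) (T n.+1) by exact: Hn.
have pS n : p n.+1 = p n / 2 by have [] := step n.
have p_ge0 n : 0 <= p n by rewrite /p /perim !addr_ge0 ?cmod_ge0.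
have pE n : p n * 2 ^+ n = p 0%N.
  elim: n => [|n IH]; first by rewrite expr0 mulr1.
  by rewrite pS exprS -IH; field.
have IE n : I 0%N <= 4 ^+ n * I n.
  elim: n => [|n IH]; first by rewrite expr0 mul1r.
  apply: le_trans IH _; rewrite exprSr -mulrA ler_wpM2l ?exprn_ge0//.
  by have [] := step n.
(* The displacement is at most [p n / 2 = p n - p n.+1], so the bounds telescope. *)
have Adist n k : cmod (A (n + k)%N - A n) <= p n - p (n + k)%N.
  elim: k => [|k IH]; first by rewrite addn0 !subrr cmod0.
  have -> : A (n + k.+1)%N - A n = (A (n + k.+1)%N - A (n + k)%N) + (A (n + k)%N - A n) by ring.
  apply: le_trans (cmodD _ _) _; rewrite addnS.
  have [_ h2 _ _] := step (n + k)%N; apply: le_trans (lerD h2 IH) _.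
  by rewrite pS -/(p (n + k)%N); lra.
have [s sinc [l sl]] := @bolzano_weierstrass_complex R A m (fun n => let: And3 h _ _ := Tm n in h).
have s_ge n : (n <= s n)%N.
  by elim: n => // n IH; apply: leq_ltn_trans IH _; exact: sinc.
have lA n : cmod (A n - l) <= p n.
  apply/ler_addgt0Pr => e e0; have [N HN] := sl e e0.
  pose k := maxn n N.
  have -> : A n - l = (A (s k) - l) - (A (s k) - A n) by ring.
  apply: le_trans (cmodD _ _) _; rewrite cmodN addrC; apply: lerD; last first.
    by apply/ltW/HN; rewrite leq_maxr.
  have nk : (n <= s k)%N by apply: leq_trans (s_ge k); rewrite leq_maxl.
  by rewrite -(subnKC nk); apply: le_trans (Adist _ _) _; rewrite gerBl.
have lm : cmod l <= m.
  apply/ler_addgt0Pr => e e0; have [N HN] := sl e e0.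
  have -> : l = A (s N) - (A (s N) - l) by ring.
  apply: le_trans (cmodD _ _) _; rewrite cmodN; apply: lerD; last exact/ltW/HN.
  by have [] := Tm (s N).
have [d fl] := fD (le_lt_trans lm mlt).
apply/eqP; rewrite -cmod_eq0 -[cmod _]/(I 0%N) eq_le cmod_ge0 andbT.
apply/ler_addgt0Pr => e e0; rewrite add0r.
(* The final estimate is [4 * e1 * p 0 ^ 2]; the added 1 covers a degenerate triangle. *)
pose e1 := e / (4 * (p 0%N ^+ 2 + 1)).
have den : 0 < 4 * (p 0%N ^+ 2 + 1) by rewrite mulr_gt0// ltr_wpDl// sqr_ge0.
have e10 : 0 < e1 by rewrite divr_gt0.
have [r r0 Hr] := fl _ e10.
(* Every vertex of the n-th triangle is within [2 * p n] of [l]: one [p n] to reach [A n], one more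
   to reach [l]. *)
have [n pn] : exists n, 2 * p n < r.
  have q0 : 0 <= 2 * p 0%N / r by rewrite divr_ge0 ?mulr_ge0// ltW.
  pose n := (Num.truncn (2 * p 0%N / r)).+1; exists n.
  have h1 : 2 * p 0%N / r < n%:R by exact: truncnS_gt.
  have h2 : (n%:R : R) < 2 ^+ n by rewrite -natrX ltr_nat ltn_expl.
  have := lt_trans h1 h2; rewrite ltr_pdivrMr// -(pE n) mulrA mulrC => h3.
  by rewrite -(ltr_pM2l (exprn_gt0 n (ltr0n R 2))).
have [ha hb hc] := Tm n.
have lt1 x : cmod x <= m -> cmod x < 1 by move=> /le_lt_trans; apply.
have pab : cmod ((T n).1.2 - (T n).1.1) <= p n.
  by rewrite cmodB /p /perim -addrA lerDl addr_ge0 ?cmod_ge0.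
have pac : cmod ((T n).2 - (T n).1.1) <= p n.
  by rewrite /p /perim lerDr addr_ge0 ?cmod_ge0.
have near x : cmod (x - A n) <= p n -> cmod (x - l) <= 2 * p n.
  move=> xA; have -> : x - l = (x - A n) + (A n - l) by ring.
  by apply: le_trans (cmodD _ _) _; rewrite mulr_natl mulr2n lerD.
have := @tri_approx l d e1 (2 * p n) _ _ _ (ltW e10) (lt1 _ ha) (lt1 _ hb) (lt1 _ hc).
have nA : cmod (A n - l) <= 2 * p n by apply: near; rewrite subrr cmod0.
move=> /(_ nA (near _ pab) (near _ pac)) => H.
have {}H : I n <= 2 * e1 * (2 * p n) * p n.
  by apply: H => h hr; apply: Hr; exact: le_lt_trans pn.
apply: le_trans (IE n) _.
apply: le_trans (ler_wpM2l (exprn_ge0 n (ler0n R 4)) H) _.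
(* The growth [4 ^ n] is absorbed by the two factors [p n], each equal to [p 0 / 2 ^ n]. *)
have -> : 4 ^+ n * (2 * e1 * (2 * p n) * p n) = 4 * e1 * (p n * 2 ^+ n) ^+ 2.
  rewrite (_ : 4 = 2 ^+ 2 :> R); last by rewrite -natrX.
  by rewrite exprAC; ring.
rewrite pE /e1 (_ : 4 * _ * _ = e * (p 0%N ^+ 2 / (p 0%N ^+ 2 + 1))); last first.
  by field; rewrite gt_eqF// ltr_wpDl// sqr_ge0.
rewrite ger_pMr// ler_pdivrMr ?ltr_wpDl ?sqr_ge0// mul1r.
by rewrite lerDl.
Qed.

(** The primitive is the integral along the radius from 0 to [z]; Goursat on the triangle 0, [z],
    [z + h] turns its increment into the integral from [z] to [z + h]. *)
Lemma analytic_primitive : exists F : C -> C, forall z, cmod z < 1 -> cdiff F z (f z).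
Proof.
exists (fun z => segint f 0 z) => z z1 e e0.
have [d fd] := fD z1.
have e2 : 0 < e / 2 by rewrite divr_gt0.
(* Accuracy 1 is enough: it gives the Lipschitz bound [cmod (f (z + q) - f z) <= (cmod d + 1) * cmod
   q], and [k] makes this at most [e / 2]. *)
have [r r0 Hr] := fd _ ltr01.
pose k := e / 2 / (cmod d + 1).
have d1 : 0 < cmod d + 1 by rewrite ltr_wpDl ?cmod_ge0.
have k0 : 0 < k by rewrite divr_gt0.
exists (Num.min (1 - cmod z) (Num.min r k)).
  by rewrite !lt_min subr_gt0 z1 r0.
move=> h; rewrite !lt_min => /and3P[h1 hr hk].
have zh1 : cmod (z + h) < 1.
  by apply: le_lt_trans (cmodD _ _) _; rewrite addrC -ltrBrDr.
have c0 : cmod (0 : C) < 1 by rewrite cmod0.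
have := goursat c0 z1 zh1; rewrite /tri (segint_sym fD c0 zh1) => /eqP.
rewrite subr_eq0 => /eqP <-.
have -> : segint f 0 z + segint f z (z + h) - segint f 0 z - f z * h =
  segint f z (z + h) - (f z * (z + h) + 0 * ((z + h - 0) * (z + h - 0) / 2) -
     (f z * z + 0 * ((z - 0) * (z - 0) / 2))) by ring.
have -> : e * cmod h = 2 * (e / 2) * cmod (z + h - z).
  by rewrite (addrC z) addrK; field.
apply: (@segint_approx R f fD (fun x => f z * x + 0 * ((x - 0) * (x - 0) / 2))
  (fun x => f z + 0 * (x - 0))) => //.
  by move=> x; exact: cdiff_quadratic.
move=> t t01; rewrite mul0r addr0.
have sh : cmod (seg z (z + h) t - z) <= cmod h.
  apply: seg_ball t01; first by rewrite subrr cmod0 cmod_ge0.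
  by rewrite addrAC subrr add0r.
set q := _ - z in sh.
have -> : seg z (z + h) t = z + q by rewrite /q; ring.
have qr := Hr q (le_lt_trans sh hr).
have -> : f (z + q) - f z = (f (z + q) - f z - d * q) + d * q by ring.
apply: le_trans (cmodD _ _) _; rewrite cmodM.
apply: (@le_trans _ _ ((cmod d + 1) * cmod q)); first by move: qr; lra.
rewrite mulrC -ler_pdivlMr//; apply: le_trans sh _; exact: ltW.
Qed.

End Goursat.

(** * Cauchy's formula and point evaluations *)

Section CircleCalculus.
Local Open Scope classical_set_scope.
Variable R : realType.
Local Notation C := (complex R).
Local Notation mu := (@lebesgue_measure R).

Lemma cdiffM (f g : C -> C) z a b : cdiff f z a -> cdiff g z b ->
  cdiff (fun x => f x * g x) z (a * g z + f z * b).
Proof.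
move=> /cdiffP fd /cdiffP gd; apply/cdiffP.
apply: (is_derive_eq (is_deriveM fd gd)).
by rewrite /GRing.scale /= addrC (mulrC a).
Qed.

Lemma cdiffV (z : C) : z != 0 -> cdiff (fun x => x^-1) z (- z^-2).
Proof.
move=> z0; apply/cdiffP.
have d1 : derivable (id : C^o -> C^o) z 1 by exact: derivable_id.
apply: DeriveDef; first exact: derivableV.
by rewrite (deriveV (f := id : C^o -> C^o))// derive_id /GRing.scale /= mulr1.
Qed.

Lemma cdiff_affine (u v z : C) : cdiff (fun x => u + v * x) z v.
Proof.
move=> e e0; exists 1 => // h _.
have -> : u + v * (z + h) - (u + v * z) - v * h = 0 by ring.
by rewrite cmod0 mulr_ge0 ?cmod_ge0// ltW.
Qed.

Lemma cdiff_comp_affine (f : C -> C) (u v z d : C) : cdiff f (u + v * z) d ->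
  cdiff (fun x => f (u + v * x)) z (d * v).
Proof.
move=> fd e e0; have v0 : 0 < cmod v + 1 by rewrite ltr_wpDl ?cmod_ge0.
have e1 : 0 < e / (cmod v + 1) by rewrite divr_gt0.
have [r r0 Hr] := fd _ e1; exists (r / (cmod v + 1)); first by rewrite divr_gt0.
move=> h hr; have vh : cmod (v * h) < r.
  rewrite cmodM; apply: (@le_lt_trans _ _ (cmod h * (cmod v + 1))); last by rewrite -ltr_pdivlMr.
  by rewrite mulrC ler_wpM2l ?cmod_ge0// lerDl.
have := Hr _ vh; rewrite mulrDr addrA mulrA => /le_trans; apply.
rewrite cmodM mulrA ler_wpM2r ?cmod_ge0// mulrAC ler_pdivrMr// ler_wpM2l ?(ltW e0)//.
by rewrite lerDl.
Qed.

(** Linearity of the integral is read off from primitives. *)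
Lemma cintB (a b : R) (h k : R -> C) : a < b -> pderivable_on a b h -> pderivable_on a b k ->
  cint a b (fun t => h t - k t) = cint a b h - cint a b k.
Proof.
move=> ab hd kd; have [H Hd] := pderivable_primitive (ltW ab) hd.
have [K Kd] := pderivable_primitive (ltW ab) kd.
rewrite (cint_FTC ab hd Hd) (cint_FTC ab kd Kd).
rewrite (@cint_FTC _ a b _ (fun t => H t - K t) ab); first by ring.
  by move=> t tab; have [d ?] := hd t tab; have [e ?] := kd t tab; exists (d - e); exact: pderivB.
by move=> t tab; apply: pderivB; [exact: Hd|exact: Kd].
Qed.

Lemma pderivMr (h : R -> C) (c : C) t d : pderiv h t d -> pderiv (fun x => h x * c) t (c * d).
Proof.
move=> hd; have := pderiv_comp hd (cdiff_affine 0 c (h t)).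
by congr pderiv; apply/funext => x /=; rewrite add0r mulrC.
Qed.

Lemma cintMr (a b : R) (h : R -> C) (c : C) : a < b -> pderivable_on a b h ->
  cint a b (fun t => h t * c) = cint a b h * c.
Proof.
move=> ab hd; have [H Hd] := pderivable_primitive (ltW ab) hd.
rewrite (cint_FTC ab hd Hd).
rewrite (@cint_FTC _ a b _ (fun t => H t * c) ab); first by ring.
  by move=> t /hd[d /pderivMr ?]; eexists; eauto.
by move=> t /Hd /pderivMr; rewrite mulrC; apply.
Qed.

Lemma cint_bound (a b M : R) (h : R -> C) : a < b -> pderivable_on a b h ->
  (forall t, a <= t <= b -> cmod (h t) <= M) -> cmod (cint a b h) <= 2 * M * (b - a).
Proof.
move=> ab hd; have [H Hd] := pderivable_primitive (ltW ab) hd.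
by rewrite (cint_FTC ab hd Hd); apply: mean_value_bound => //; exact: ltW.
Qed.

Lemma cmod_continuous (h : R -> C) t d : pderiv h t d -> {for t, continuous (fun x => cmod (h x))}.
Proof.
move=> hd.
have h1 := is_derive_continuous (pderiv_Re hd).
have h2 := is_derive_continuous (pderiv_Im hd).
have -> : (fun x => cmod (h x)) = (fun x => Num.sqrt (Re (h x) * Re (h x) + Im (h x) * Im (h x))).
  by apply/funext => x; rewrite -!expr2 -cmod_sqr sqrtr_sqr ger0_norm ?cmod_ge0.
apply: (@continuous_comp _ _ _ (fun x => Re (h x) * Re (h x) + Im (h x) * Im (h x)) Num.sqrt).
  by apply: continuousD; apply: continuousM.
exact: sqrt_continuous.
Qed.

(** Sequential compactness: pairs violating the claim accumulate at some [l] with [cmod l <= m < 1],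
    where differentiability puts both values within [e / 2] of [f l]. *)
Lemma uniformly_continuous_disk (f : C -> C) (m e : R) : m < 1 -> 0 < e ->
  (forall z, cmod z < 1 -> exists d, cdiff f z d) ->
  exists2 r : R, 0 < r & forall x y : C, cmod x <= m -> cmod y <= m -> cmod (y - x) < r ->
    cmod (f y - f x) <= e.
Proof.
move=> m1 e0 fD; apply: contrapT => H.
have /choice[u Hu] : forall n : nat, exists u : C * C, [/\ cmod u.1 <= m, cmod u.2 <= m,
    cmod (u.2 - u.1) < n.+1%:R^-1 & e < cmod (f u.2 - f u.1)].
  move=> n; apply: contrapT => H'; apply: H; exists n.+1%:R^-1; first by rewrite invr_gt0.
  move=> x y xm ym xy; rewrite leNgt; apply/negP => ef; apply: H'.
  by exists (x, y).
have [s sinc [l sl]] := @bolzano_weierstrass_complex R (fun n => (u n).1) m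
  (fun n => let: And4 h _ _ _ := Hu n in h).
have s_ge n : (n <= s n)%N.
  by elim: n => // n IH; apply: leq_ltn_trans IH _; exact: sinc.
have lm : cmod l <= m.
  apply/ler_addgt0Pr => e1 e10; have [N HN] := sl e1 e10.
  have -> : l = (u (s N)).1 - ((u (s N)).1 - l) by ring.
  apply: le_trans (cmodD _ _) _; rewrite cmodN; apply: lerD; last exact/ltW/HN.
  by have [] := Hu (s N).
have [d fl] := fD _ (le_lt_trans lm m1).
have [r r0 Hr] := fl _ ltr01.
have d1 : 0 < cmod d + 1 by rewrite ltr_wpDl ?cmod_ge0.
pose q := Num.min r (e / 2 / (cmod d + 1)).
have q0 : 0 < q by rewrite lt_min r0 !divr_gt0.
have near x : cmod (x - l) < q -> cmod (f x - f l) <= e / 2.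
  rewrite lt_min => /andP[xr xq]; have := Hr _ xr; rewrite (addrCA l x) subrr addr0 mul1r => fx.
  have -> : f x - f l = (f x - f l - d * (x - l)) + d * (x - l) by ring.
  apply: le_trans (cmodD _ _) _; rewrite cmodM.
  move: xq; rewrite ltr_pdivlMr// => xq.
  by apply: le_trans (lerD fx (lexx _)) _; apply/ltW; apply: le_lt_trans xq; rewrite mulrDr mulr1 addrC mulrC.
have [N HN] := sl _ (divr_gt0 q0 (ltr0n R 2)).
(* The second term brings the distance within the pair below [q / 2]. *)
pose k := maxn N (Num.truncn (2 / q)).+1.
have [_ _ c1 c2] := Hu (s k).
have a1 := HN k (leq_maxl _ _).
have a2 : cmod ((u (s k)).2 - (u (s k)).1) < q / 2.
  apply: lt_trans c1 _; rewrite -(invf_div 2 q) ltf_pV2 ?posrE ?divr_gt0//.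
  apply: lt_le_trans (truncnS_gt _) _.
  by rewrite ler_nat; apply: leq_trans (leqW (s_ge k)); rewrite leq_maxr.
have b1 : cmod (f (u (s k)).1 - f l) <= e / 2 by apply: near; lra.
have b2 : cmod (f (u (s k)).2 - f l) <= e / 2.
  apply: near; rewrite (_ : _ - l = ((u (s k)).2 - (u (s k)).1) + ((u (s k)).1 - l)); last by ring.
  by apply: le_lt_trans (cmodD _ _) _; lra.
have : cmod (f (u (s k)).2 - f (u (s k)).1) <= e.
  rewrite (_ : _ - _ = (f (u (s k)).2 - f l) - (f (u (s k)).1 - f l)); last by ring.
  by apply: le_trans (cmodD _ _) _; rewrite cmodN; lra.
by rewrite leNgt c2.
Qed.

(* The factor [s'] degenerates at 0: the hypothesis with [s = 0] gives continuity
   there, and away from 0 it says that the derivative vanishes uniformly. *)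
Lemma flat_interval_eq (J : R -> C) :
  (forall e, 0 < e -> exists2 r : R, 0 < r & forall s s', 0 <= s <= 1 -> 0 <= s' <= 1 ->
     `|s' - s| < r -> s' * cmod (J s' - J s) <= e * `|s' - s|) -> J 1 = J 0.
Proof.
move=> HJ; apply/eqP; rewrite -subr_eq0 -cmod_eq0 eq_le cmod_ge0 andbT.
apply/ler_addgt0Pr => e e0; rewrite add0r.
have e2 : 0 < e / 2 by rewrite divr_gt0.
have [r r0 Hr] := HJ _ e2.
(* On [[0, a]] a single use of the hypothesis, from 0 to [a], suffices since its factor [s'] equals
   [a] and cancels. *)
pose a := Num.min (r / 2) (1 / 2).
have a0 : 0 < a by rewrite lt_min !divr_gt0.
have ar : a < r by rewrite gt_min; apply/orP; left; lra.
have a1 : a <= 1 / 2 by rewrite ge_min lexx orbT.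
have Ja : cmod (J a - J 0) <= e / 2.
  have := Hr 0 a; rewrite lexx ler01 ltW//= subr0 (ger0_norm (ltW a0)) => /(_ isT).
  by rewrite mulrC ler_pM2r//; apply=> //; lra.
(* On [[a, 1]] the factor [s'] is at least [a], which the accuracy [e / 2 * a] compensates; the
   interval is then crossed in [N] steps of length [d < q]. *)
have [q q0 Hq] := HJ _ (mulr_gt0 e2 a0).
pose N := (Num.truncn (q^-1)).+1.
have N0 : 0 < N%:R :> R by rewrite ltr0n.
pose d := (1 - a) / N%:R.
have d0 : 0 < d by rewrite divr_gt0//; lra.
have dq : d < q.
  rewrite ltr_pdivrMr// mulrC -ltr_pdivrMr//; apply: le_lt_trans (truncnS_gt _).
  by rewrite ler_piMl ?invr_ge0 ?(ltW q0)//; lra.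
have dN : N%:R * d = 1 - a by rewrite /d mulrC divfK// gt_eqF.
have steps k : (k <= N)%N -> cmod (J (a + k%:R * d) - J a) <= e / 2 * (k%:R * d).
  elim: k => [|k IH] kN; first by rewrite mul0r addr0 subrr cmod0 mulr0.
  have kd : a + k.+1%:R * d <= 1.
    rewrite addrC -lerBrDr -dN ler_wpM2r ?(ltW d0)// ler_nat//.
  have k0 : 0 <= k%:R * d by rewrite mulr_ge0// ltW.
  have kS : k.+1%:R * d = k%:R * d + d by rewrite -natr1 mulrDl mul1r.
  have := Hq (a + k%:R * d) (a + k.+1%:R * d).
  rewrite kS in kd *; rewrite (_ : a + (k%:R * d + d) - _ = d); last by ring.
  rewrite (ger0_norm (ltW d0)) => /(_ _ _ dq) H.
  have {}H : cmod (J (a + (k%:R * d + d)) - J (a + k%:R * d)) <= e / 2 * d.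
    rewrite -(ler_pM2l a0) (_ : a * (e / 2 * d) = e / 2 * a * d); last by ring.
    have h1 : 0 <= a + k%:R * d <= 1 by lra.
    have h2 : 0 <= a + (k%:R * d + d) <= 1 by lra.
    apply: le_trans (H h1 h2).
    by rewrite ler_wpM2r ?cmod_ge0//; lra.
  rewrite (_ : _ - J a = (J (a + (k%:R * d + d)) - J (a + k%:R * d)) + (J (a + k%:R * d) - J a)); last by ring.
  apply: le_trans (cmodD _ _) _; rewrite mulrDr addrC; apply: lerD => //.
  exact: IH (ltnW kN).
have := steps N (leqnn _); rewrite dN addrCA subrr addr0 => J1.
rewrite (_ : J 1 - J 0 = (J 1 - J a) + (J a - J 0)); last by ring.
apply: le_trans (cmodD _ _) _; apply: le_trans (lerD J1 Ja) _.
rewrite [leRHS](splitr e) lerD2r ger_pMr//; lra.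
Qed.

End CircleCalculus.

(** * Bounding [f w] by the mean of its modulus over a circle *)

Section PointEvaluation.
Local Open Scope classical_set_scope.
Variable R : realType.
Local Notation C := (complex R).
Local Notation mu := (@lebesgue_measure R).
Local Notation iC := ('i%C : C).
Local Notation T := (pi *+ 2 : R).

Lemma T_gt0 : 0 < T. Proof. by rewrite pmulrn_lgt0 ?pi_gt0. Qed.

Lemma cmod_expi (t : R) : cmod (expi t) = 1.
Proof. by rewrite /cmod /expi /= cos2Dsin2 sqrtr1. Qed.

Lemma expi_2pi : expi T = expi 0 :> C.
Proof. by rewrite /expi cos2pi sin2pi cos0 sin0. Qed.

Lemma pderiv_expi (t : R) : pderiv (@expi R) t (iC * expi t).
Proof.
have -> : iC * expi t = (- sin t +i* cos t)%C.
  by rewrite /expi; simpc.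
by apply/pderivP; split=> /=; [exact: is_derive_cos|exact: is_derive_sin].
Qed.

Lemma circle_continuous (f : C -> C) (r t : R) : 0 <= r < 1 ->
  (forall z, cmod z < 1 -> exists d, cdiff f z d) ->
  {for t, continuous (fun x => cmod (f (r%:C%C * expi x)))}.
Proof.
move=> /andP[r0 r1] fD; have [|d fd] := fD (0 + r%:C%C * expi t).
  by rewrite add0r cmodM cmodR cmod_expi mulr1 ger0_norm.
have := pderiv_comp (pderiv_expi t) (cdiff_comp_affine fd).
rewrite (_ : _ \o _ = fun x => f (r%:C%C * expi x)); first exact: cmod_continuous.
by apply/funext => x /=; rewrite add0r.
Qed.

(** The left-hand quantity is the real part of [z / (z - w)], and twice the real part of [z] times
    the conjugate of [z - w] exceeds [cmod (z - w) ^ 2] by exactly [cmod z ^ 2 - cmod w ^ 2]. *)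
Lemma Im_kernel_ge (w z : C) : cmod w <= cmod z -> z - w != 0 ->
  1 / 2 <= Im (iC * z * (z - w)^-1).
Proof.
move=> wz z0; have : cmod w ^+ 2 <= cmod z ^+ 2 by rewrite ler_pXn2r ?nnegrE ?cmod_ge0.
rewrite !cmod_sqr; clear wz; case: w z z0 => [a b] [x y] /= z0 h.
have n0 : 0 < (x - a) ^+ 2 + (y - b) ^+ 2.
  rewrite lt_neqAle addr_ge0 ?sqr_ge0// andbT eq_sym; apply: contra z0.
  rewrite paddr_eq0 ?sqr_ge0// !sqrf_eq0 !subr_eq0 => /andP[/eqP-> /eqP->].
  by [].
set nn := (x - a) ^+ 2 + (y - b) ^+ 2 in n0 *.
rewrite (_ : _ + _ = (x * (x - a) + y * (y - b)) / nn); last by field; rewrite lt0r_neq0.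
by rewrite ler_pdivlMr// /nn; nra.
Qed.

Variables (w : C) (w1 : cmod w < 1).

Let r : R := (1 + cmod w) / 2.
Let r_lt1 : r < 1. Proof. by have := w1; rewrite /r; lra. Qed.
Let r_gtw : cmod w < r. Proof. by have := w1; rewrite /r; lra. Qed.
Let r_gt0 : 0 < r. Proof. exact: le_lt_trans (cmod_ge0 w) r_gtw. Qed.

Let zeta (t : R) : C := r%:C%C * expi t - w.
(** As [zeta' = i (zeta + w)], the value [g (zeta t)] is the logarithmic derivative [zeta' / zeta].
    Writing it as a function of [zeta] allows the chain rule [pderiv_comp]. *)
Let g (x : C) : C := iC * (x + w) * x^-1.
Let G : R := r / (r - cmod w).

Let G_ge0 : 0 <= G. Proof. by rewrite divr_ge0 ?subr_ge0 ?ltW. Qed.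

Let cmod_circle t : cmod (r%:C%C * expi t) = r.
Proof. by rewrite cmodM cmodR cmod_expi mulr1 gtr0_norm. Qed.

Let zeta_ge t : r - cmod w <= cmod (zeta t).
Proof.
rewrite lerBlDr -(cmod_circle t).
rewrite {1}(_ : r%:C%C * expi t = zeta t + w) ?cmodD// /zeta; ring.
Qed.

Let zeta_le t : cmod (zeta t) <= 2.
Proof.
by apply: le_trans (cmodD _ _) _; rewrite cmodN cmod_circle; have := w1; have := r_lt1; lra.
Qed.

Let zeta_neq0 t : zeta t != 0.
Proof. by rewrite -cmod_gt0; apply: lt_le_trans (zeta_ge t); rewrite subr_gt0. Qed.

Let g_le t : cmod (g (zeta t)) <= G.
Proof.
rewrite /g /zeta subrK !cmodM cmodV -/(zeta t) -!cmodM (mulrC iC) -mulrA cmodM cmodM.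
rewrite (_ : cmod iC = 1) ?mulr1; last by rewrite /cmod /= expr0n expr1n add0r sqrtr1.
rewrite -cmodM cmod_circle ler_wpM2l ?(ltW r_gt0)//.
by rewrite lef_pV2 ?posrE ?subr_gt0// ?cmod_gt0.
Qed.

Let pderiv_zeta t : pderiv zeta t (iC * (zeta t + w)).
Proof.
have := pderiv_comp (pderiv_expi t) (cdiff_affine (- w) r%:C%C (expi t)).
rewrite (_ : _ * _ = iC * (zeta t + w)); last by rewrite /zeta; ring.
by congr pderiv; apply/funext => x /=; rewrite /zeta addrC.
Qed.

Let g_cdiff (x : C) : x != 0 -> exists d, cdiff g x d.
Proof.
move=> x0; eexists; apply: cdiffM (cdiffV x0).
rewrite (_ : (fun x0 => iC * (x0 + w)) = (fun x0 => iC * w + iC * x0)).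
  exact: cdiff_affine.
by apply/funext => y; ring.
Qed.

(** The point lies on the segment from [w] to a point of the circle of radius [r]. *)
Let in_ball (s t : R) : 0 <= s <= 1 -> cmod (w + s%:C%C * zeta t) <= r.
Proof.
move=> s01; rewrite mulrC -/(seg w (r%:C%C * expi t) s) -(subr0 (seg _ _ _)).
by apply: seg_ball => //; rewrite subr0 ?cmod_circle// ltW.
Qed.

(** The circle is contracted to the point [w] as [s] runs from 1 to 0. *)
Let circle_int (f : C -> C) (s : R) : C :=
  cint 0 T (fun t => f (w + s%:C%C * zeta t) * g (zeta t)).

Section Kernel.
Variables f F : C -> C.
Hypothesis fD : forall z, cmod z < 1 -> exists d, cdiff f z d.
Hypothesis FD : forall z, cmod z < 1 -> cdiff F z (f z).

Let J := circle_int f.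
Let K (s : R) : C := cint 0 T (fun t => F (w + s%:C%C * zeta t) * (g (zeta t) * (zeta t)^-1)).

Let in_disk_ball (s t : R) : 0 <= s <= 1 -> cmod (w + s%:C%C * zeta t) < 1.
Proof. by move=> s01; exact: le_lt_trans (in_ball t s01) r_lt1. Qed.

Let J_pd (s : R) : 0 <= s <= 1 ->
  pderivable_on 0 T (fun t => f (w + s%:C%C * zeta t) * g (zeta t)).
Proof.
move=> s01 t _; have [d fd] := fD (in_disk_ball t s01).
have [e ge] := g_cdiff (zeta_neq0 t).
eexists; exact: (pderiv_comp (pderiv_zeta t) (cdiffM (cdiff_comp_affine fd) ge)).
Qed.

Let K_pd (s : R) : 0 <= s <= 1 ->
  pderivable_on 0 T (fun t => F (w + s%:C%C * zeta t) * (g (zeta t) * (zeta t)^-1)).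
Proof.
move=> s01 t _; have fd := FD (in_disk_ball t s01).
have [e ge] := g_cdiff (zeta_neq0 t).
eexists; exact: (pderiv_comp (pderiv_zeta t)
  (cdiffM (cdiff_comp_affine fd) (cdiffM ge (cdiffV (zeta_neq0 t))))).
Qed.

(* Integration by parts: F (w + s zeta) / zeta is a periodic primitive. *)
Let K_eq (s : R) : 0 <= s <= 1 -> K s = J s * s%:C%C.
Proof.
move=> s01; apply/esym/eqP; rewrite -subr_eq0 /J /circle_int -cintMr ?T_gt0//; last exact: J_pd.
rewrite -cintB ?T_gt0//; last 2 first.
- move=> t tT; have [d /pderivMr dd] := J_pd s01 tT; eexists; exact: dd.
- exact: K_pd.
have Hd t : pderiv (fun t => F (w + s%:C%C * zeta t) * (zeta t)^-1) t
    (f (w + s%:C%C * zeta t) * g (zeta t) * s%:C%C -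
     F (w + s%:C%C * zeta t) * (g (zeta t) * (zeta t)^-1)).
  have := pderiv_comp (pderiv_zeta t)
    (cdiffM (cdiff_comp_affine (FD (in_disk_ball t s01))) (cdiffV (zeta_neq0 t))).
  congr pderiv; rewrite /g; field; exact: zeta_neq0.
rewrite (@cint_FTC _ 0 T _ (fun t => F (w + s%:C%C * zeta t) * (zeta t)^-1)) ?T_gt0//.
  by rewrite /zeta expi_2pi subrr.
move=> t tT; have [d1 /(@pderivMr _ _ s%:C%C) h1] := J_pd s01 tT; have [d2 h2] := K_pd s01 tT.
by eexists; exact: pderivB h1 h2.
Qed.

(** Uniform continuity of [f] on the closed disk makes [q] independent of [x] and [y], as required
    for integrating the expansion over the circle. The mean value bound is applied to [F] minus its
    linear part along the segment. *)
Let F_taylor (e : R) : 0 < e -> exists2 q : R, 0 < q & forall x y : C, cmod x <= r -> cmod y <= r ->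
  cmod (y - x) < q -> cmod (F y - F x - (y - x) * f x) <= 2 * e * cmod (y - x).
Proof.
move=> e0; have [q q0 Hq] := uniformly_continuous_disk r_lt1 e0 fD.
exists q => // x y xr yr xy.
have Hd t : 0 <= t <= 1 -> pderiv (fun t => F (seg x y t) - seg x y t * f x) t
    (f (seg x y t) * (y - x) - f x * (y - x)).
  move=> t01; apply: pderivB.
    apply: (pderiv_comp (pderiv_seg x y t) (FD _)).
    by apply: seg_disk t01; [exact: le_lt_trans xr r_lt1|exact: le_lt_trans yr r_lt1].
  exact: pderivMr (pderiv_seg x y t).
have := @mean_value_bound _ 0 1 (e * cmod (y - x)) _ _ ler01 Hd.
rewrite subr0 mulr1 mulrA.
have -> : seg x y 1 = y by rewrite /seg rmorph1; ring.
have -> : seg x y 0 = x by rewrite /seg rmorph0; ring.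
rewrite (_ : F y - y * f x - _ = F y - F x - (y - x) * f x); last by ring.
apply=> t t01; rewrite -mulrBl cmodM ler_wpM2r ?cmod_ge0//; apply: Hq => //.
  by rewrite -(subr0 (seg _ _ _)) seg_ball ?subr0.
apply: le_lt_trans xy; apply: seg_ball t01 => //.
by rewrite subrr cmod0 cmod_ge0.
Qed.

(** Since [K s = s J s], the difference [s' (J s' - J s)] equals [K s' - K s - (s' - s) J s], whose
    integrand is the Taylor remainder of [F] times [g (zeta) / zeta]. *)
Let J_flat (e : R) : 0 < e -> exists2 q : R, 0 < q & forall s s' : R, 0 <= s <= 1 -> 0 <= s' <= 1 ->
     `|s' - s| < q -> s' * cmod (J s' - J s) <= e * `|s' - s|.
Proof.
(* The constant collects a 2 from [cint_bound], a 2 from [F_taylor], the bound [G] on [g], and the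
   length [T]. *)
move=> e0; pose A : R := 2 * (2 * G) * T.
have A0 : 0 <= A by exact: mulr_ge0 (mulr_ge0 (ler0n _ 2) (mulr_ge0 (ler0n _ 2) G_ge0)) (ltW T_gt0).
have A1 : 0 < A + 1 by rewrite ltr_wpDl.
have [q q0 Hq] := F_taylor (divr_gt0 e0 A1).
(* The points compared differ by [(s' - s) zeta], and [cmod zeta <= 2]. *)
exists (q / 2); first by rewrite divr_gt0.
move=> s s' s01 s'01 ss'.
have s'0 : 0 <= s' by case/andP: s'01.
have -> : s' * cmod (J s' - J s) = cmod (K s' - K s - J s * (s' - s)%:C%C).
  rewrite (K_eq s01) (K_eq s'01).
  have -> : J s' * s'%:C%C - J s * s%:C%C - J s * (s' - s)%:C%C = (J s' - J s) * s'%:C%C.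
    by rewrite rmorphB /=; ring.
  by rewrite cmodM cmodR ger0_norm// mulrC.
have JM : pderivable_on 0 T (fun t => f (w + s%:C%C * zeta t) * g (zeta t) * (s' - s)%:C%C).
  by move=> t tT; have [d /pderivMr dd] := J_pd s01 tT; eexists; exact: dd.
have KB : pderivable_on 0 T (fun t => F (w + s'%:C%C * zeta t) * (g (zeta t) * (zeta t)^-1)
    - F (w + s%:C%C * zeta t) * (g (zeta t) * (zeta t)^-1)).
  move=> t tT; have [d d1] := K_pd s'01 tT; have [d' d2] := K_pd s01 tT.
  by eexists; exact: pderivB d1 d2.
rewrite /K -cintB ?T_gt0//; [|exact: K_pd|exact: K_pd].
rewrite /J /circle_int -cintMr ?T_gt0//; last exact: J_pd.
rewrite -cintB ?T_gt0//.
apply: le_trans (@cint_bound _ 0 T (2 * (e / (A + 1)) * `|s' - s| * G) _ T_gt0 _ _) _.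
- move=> t tT; have [d d1] := KB t tT; have [d' d2] := JM t tT.
  by eexists; exact: pderivB d1 d2.
- move=> t tT.
  have yx : w + s'%:C%C * zeta t - (w + s%:C%C * zeta t) = (s' - s)%:C%C * zeta t.
    by rewrite rmorphB /=; ring.
  have := Hq _ _ (in_ball t s01) (in_ball t s'01); rewrite yx cmodM cmodR.
  have -> : `|s' - s| * cmod (zeta t) < q.
    apply: (@le_lt_trans _ _ (`|s' - s| * 2)); first by rewrite ler_wpM2l.
    by rewrite -ltr_pdivlMr.
  move=> /(_ isT) H.
  set u := F _ - F _ - _ in H.
  rewrite (_ : _ - _ = u * (g (zeta t) * (zeta t)^-1)); last first.
    by rewrite /u; field; exact: zeta_neq0.
  rewrite (cmodM u) (cmodM (g _)) cmodV.
  have z0 : 0 < cmod (zeta t) by rewrite cmod_gt0.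
  (* The factor [cmod (zeta t)] in the remainder bound cancels the division by [zeta t]. *)
  rewrite mulrCA mulrC ler_pM ?mulr_ge0 ?invr_ge0 ?cmod_ge0//.
  by rewrite ler_pdivrMr// -!mulrA; move: H; rewrite -!mulrA.
rewrite subr0.
have -> : 2 * (2 * (e / (A + 1)) * `|s' - s| * G) * T = e * `|s' - s| * (A / (A + 1)).
  move: (lt0r_neq0 A1); set D := A + 1 => D0.
  by rewrite /A; field; exact: D0.
by rewrite ler_piMr ?mulr_ge0 ?(ltW e0)// ler_pdivrMr// mul1r lerDl.
Qed.

Let W : C := cint 0 T (fun t => g (zeta t)).

Let g_pd : pderivable_on 0 T (fun t => g (zeta t)).
Proof.
by move=> t _; have [e ge] := g_cdiff (zeta_neq0 t); eexists; exact: (pderiv_comp (pderiv_zeta t) ge).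
Qed.

(* Re (z / (z - w)) >= 1/2 on the circle, so the winding integral W is bounded below
   without being computed. *)
Let W_ge : pi <= cmod W.
Proof.
apply: le_trans (Im_le_cmod W); apply: le_trans (ler_norm _); rewrite /W /cint /=.
have gc : {within `[0, T], continuous (fun t => Im (g (zeta t)))}.
  by apply: for_within_continuous => t; exact: pderivable_Im g_pd.
apply: (@le_trans _ _ (\int[mu]_(t in `[0%R, T]) (1 / 2 : R))%R).
  have mT : mu `[0%R, T] = T%:E by rewrite lebesgue_measure_itv /= lte_fin T_gt0 oppr0 adde0.
  rewrite Rintegral_cst// [X in fine X](_ : _ = T%:E) /=; last exact: mT.
  by rewrite le_eqVlt; apply/orP; left; apply/eqP; rewrite -mulr_natr; field.
apply: le_Rintegral => //.
- apply: continuous_compact_integrable; first exact: segment_compact.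
  by apply: continuous_subspaceT => x; exact: cvg_cst.
- by apply: continuous_compact_integrable; [exact: segment_compact|].
move=> t _.
rewrite /g (_ : zeta t + w = r%:C%C * expi t); last by rewrite /zeta; ring.
apply: Im_kernel_ge; last exact: zeta_neq0.
by rewrite cmod_circle ltW.
Qed.

(** [J 0] is [W * f w] and [J 1] integrates over the circle itself. They agree by flatness, so the
    lower bound [pi] on [cmod W] and the upper bound [G] on the kernel give the estimate. *)
Lemma point_evaluation_kernel :
  cmod (f w) <= 2 * G / pi * (\int[mu]_(t in `[0%R, T]) cmod (f (r%:C%C * expi t)))%R.
Proof.
have Jw : J 0 = W * f w.
  rewrite /W -cintMr ?T_gt0//; congr cint; apply/funext => t.
  by rewrite rmorph0 mul0r addr0 mulrC.
have o01 : 0 <= (1 : R) <= 1 by rewrite ler01 lexx.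
have E : (fun t => f (w + 1%:C%C * zeta t) * g (zeta t)) =
         (fun t => f (r%:C%C * expi t) * g (zeta t)).
  by apply/funext => t; congr (f _ * _); rewrite rmorph1 mul1r /zeta; ring.
have Jpd := J_pd o01; rewrite E in Jpd.
have J1 : cmod (J 1) <= 2 * (\int[mu]_(t in `[0%R, T]) cmod (f (r%:C%C * expi t) * g (zeta t)))%R.
  rewrite /J /circle_int E; apply: cmod_cint => //.
  by apply: for_within_continuous => t /Jpd[d]; exact: cmod_continuous.
have r01 : 0 <= r < 1 by rewrite (ltW r_gt0) r_lt1.
have fi : mu.-integrable `[0%R, T] (EFin \o (fun t => cmod (f (r%:C%C * expi t)))).
  apply: continuous_compact_integrable; first exact: segment_compact.
  by apply: for_within_continuous => t _; exact: circle_continuous.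
rewrite mulrAC ler_pdivlMr ?pi_gt0// mulrC.
apply: (@le_trans _ _ (cmod (J 1))).
  rewrite (flat_interval_eq J_flat) Jw cmodM.
  by rewrite ler_wpM2r ?cmod_ge0// W_ge.
apply: le_trans J1 _; rewrite -mulrA ler_wpM2l// -RintegralZl//.
apply: le_Rintegral => //.
- apply: continuous_compact_integrable; first exact: segment_compact.
  by apply: for_within_continuous => t /Jpd[d]; exact: cmod_continuous.
- apply: continuous_compact_integrable; first exact: segment_compact.
  apply: for_within_continuous => t _; apply: continuousM; first exact: cvg_cst.
  exact: circle_continuous.
by move=> t _; rewrite cmodM mulrC ler_wpM2r ?cmod_ge0.
Qed.
End Kernel.

(** The radius and the constant are fixed by [w] before [f] is chosen, which makes the bound uniform
    in [f]. *)
Lemma point_evaluation : exists r A : R, [/\ 0 < r < 1, 0 <= A &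
  forall f, (forall z, cmod z < 1 -> exists d, cdiff f z d) ->
  cmod (f w) <= A * (\int[mu]_(t in `[0%R, T]) cmod (f (r%:C%C * expi t)))%R].
Proof.
exists r, (2 * G / pi); split.
- by rewrite r_gt0 r_lt1.
- by rewrite divr_ge0 ?pi_ge0// mulr_ge0 ?G_ge0.
move=> f fD; have [F Fd] := analytic_primitive fD.
exact: (point_evaluation_kernel fD Fd).
Qed.

End PointEvaluation.

(** * Hardy spaces *)

Section HardySpaces.
Local Open Scope classical_set_scope.
Variable R : realType.
Local Notation C := (complex R).
Local Notation mu := (@lebesgue_measure R).
Implicit Types (f g u phi : C -> C) (p : R).

Lemma analyticP f : analytic_on_disk f <-> forall z, cmod z < 1 -> exists d, cdiff f z d.
Proof.
split=> H z.
  rewrite -in_diskE => /H fz; exists ('D_1 (f : C^o -> C^o) z).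
  exact/cdiffP/derivableP.
by rewrite in_diskE => /H[d /cdiffP[]].
Qed.

Lemma cdiff_cderiv f z d : cdiff f z d -> cderiv f z = d.
Proof. by move=> /cdiffP fd; rewrite /cderiv derive1E; exact: derive_val. Qed.

Lemma in_disk_near (z : C) : in_disk z -> \forall x \near (z : C^o), in_disk (x : C).
Proof.
move=> z1; apply/nbhs_ballP; exists (1 - `|z|); first by rewrite /= subr_gt0.
move=> x; rewrite /ball /= => zx; rewrite /in_disk.
rewrite -(subrK z x) addrC; apply: le_lt_trans (ler_normD _ _) _.
by rewrite addrC -ltrBrDr distrC.
Qed.

(** Functions are total on the plane while only their values on the disk matter. As the disk is
    open, derivatives there depend on those values alone; the congruence lemmas that follow
    transport this to the spaces and norms. *)
Lemma cderiv_congr f g : (forall z, in_disk z -> f z = g z) ->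
  forall z, in_disk z -> cderiv f z = cderiv g z.
Proof.
move=> fg z z1; rewrite /cderiv !derive1E; apply: (@near_eq_derive C C^o C^o f g z 1).
by apply: filterS (in_disk_near z1) => x; exact: fg.
Qed.

Lemma analytic_congr f g : (forall z, in_disk z -> f z = g z) ->
  analytic_on_disk f -> analytic_on_disk g.
Proof.
move=> fg fD z z1; apply: near_eq_derivable (fD z z1).
by apply: filterS (in_disk_near z1) => x; exact: fg.
Qed.

Lemma in_disk_circle (r t : R) : 0 < r < 1 -> in_disk (r%:C%C * expi t).
Proof.
by move=> /andP[r0 r1]; rewrite in_diskE cmodM cmodR cmod_expi mulr1 gtr0_norm.
Qed.

Lemma Hp_normp_congr p f g : (forall z, in_disk z -> f z = g z) -> Hp_normp p f = Hp_normp p g.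
Proof.
move=> fg; rewrite /Hp_normp; congr ereal_sup; apply: eq_imagel => r /=.
rewrite in_itv /= => r01; congr (_ * _)%E; apply: eq_integral => t _.
by rewrite fg//; exact: in_disk_circle.
Qed.

Lemma Hp_congr p f g : (forall z, in_disk z -> f z = g z) -> Hp p f -> Hp p g.
Proof.
by move=> fg [fD fb]; split; [exact: analytic_congr fD|rewrite -(Hp_normp_congr p fg)].
Qed.

Lemma Hp_norm_congr p f g : (forall z, in_disk z -> f z = g z) -> Hp_norm p f = Hp_norm p g.
Proof. by move=> fg; rewrite /Hp_norm (Hp_normp_congr p fg). Qed.

Lemma Sp_congr p f g : (forall z, in_disk z -> f z = g z) -> Sp p f -> Sp p g.
Proof.
move=> fg [fD fH]; split; first exact: analytic_congr fD.
by apply: Hp_congr fH; exact: cderiv_congr.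
Qed.

Lemma in_disk0 : in_disk (0 : C).
Proof. by rewrite in_diskE cmod0. Qed.

Lemma Sp_norm_congr p f g : (forall z, in_disk z -> f z = g z) -> Sp_norm p f = Sp_norm p g.
Proof.
move=> fg; have E0 : cmod (f 0) = cmod (g 0) by congr cmod; exact/fg/in_disk0.
exact: (f_equal2 (fun a b : R => a + b) E0 (Hp_norm_congr p (cderiv_congr fg))).
Qed.

Lemma Hp_norm_ge0 p f : 0 <= Hp_norm p f.
Proof. exact: powR_ge0. Qed.

Lemma Hp_norm_le_Sp_norm p f : Hp_norm p (cderiv f) <= Sp_norm p f.
Proof. by rewrite /Sp_norm -[X in X <= _]add0r lerD2r cmod_ge0. Qed.

(** The value at 0 is left free: 0 makes the two norms agree, and a limit of point values is
    prescribed when a limit function is rebuilt from its derivative. *)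
Lemma Hp_primitive p u (c : C) : Hp p u ->
  exists F, [/\ Sp p F, F 0 = c & forall z, in_disk z -> cderiv F z = u z].
Proof.
move=> Hu; have [/analyticP uD _] := Hu; have [F FD] := analytic_primitive uD.
pose F1 z := F z + (c - F 0).
have F1D z : in_disk z -> cdiff F1 z (u z).
  rewrite in_diskE => /FD Fz e e0; have [r r0 Hr] := Fz e e0.
  by exists r => // h /Hr; rewrite /F1 opprD addrACA subrr addr0.
have F1E z : in_disk z -> cderiv F1 z = u z by move=> /F1D /cdiff_cderiv.
exists F1; split; [split| |exact: F1E]; last by rewrite /F1 addrCA subrr addr0.
  by apply/analyticP => z; rewrite -in_diskE => /F1D ?; exists (u z).
by apply: Hp_congr Hu => z /F1E.
Qed.

Lemma cderivB f g z : analytic_on_disk f -> analytic_on_disk g -> in_disk z ->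
  cderiv (f \- g) z = cderiv f z - cderiv g z.
Proof.
move=> fD gD z1; rewrite /cderiv !derive1E.
by rewrite (deriveB (f := f : C^o -> C^o))//; [exact: fD|exact: gD].
Qed.

Lemma analytic_comp f phi : analytic_on_disk f -> self_map phi -> analytic_on_disk (Cop phi f).
Proof.
move=> fD [pD pm] z z1; apply/derivable1_diffP.
apply: (@differentiable_comp _ _ _ _ (phi : C^o -> C^o) (f : C^o -> C^o)).
  exact/derivable1_diffP/pD.
exact/derivable1_diffP/fD/pm.
Qed.

(** An elementary substitute for Hölder's inequality when passing from p-th power means to means of
    the modulus. *)
Lemma le1_powR p (x : R) : 1 < p -> 0 <= x -> x <= 1 + x `^ p.
Proof.
move=> p1 x0; have [x1|x1] := leP x 1; first by rewrite ler_wpDr ?powR_ge0.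
rewrite ler_wpDl// -[leLHS]powRr1//; apply: ler_powR; exact: ltW.
Qed.

Lemma Hp_normp_ge0 p f : (0 <= Hp_normp p f)%E.
Proof.
apply: ereal_sup_ge; eexists; first by exists (1 / 2) => //=; rewrite in_itv /=; lra.
rewrite mule_ge0//; first by rewrite lee_fin invr_ge0 mulrn_wge0 ?pi_ge0.
by apply: integral_ge0 => t _; rewrite lee_fin powR_ge0.
Qed.

(** [fine] sends [+oo] to 0, so a bound on [Hp_norm] controls the supremum only through membership
    in [Hp], which makes it finite. *)
Lemma Hp_normp_le p f (M : R) : 1 < p -> Hp p f -> Hp_norm p f <= M ->
  (Hp_normp p f <= (M `^ p)%:E)%E.
Proof.
move=> p1 [_ fb] fM; have f0 := Hp_normp_ge0 p f.
have fin : Hp_normp p f \is a fin_num by rewrite ge0_fin_numE.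
rewrite -(fineK fin) lee_fin.
have -> : fine (Hp_normp p f) = Hp_norm p f `^ p.
  rewrite /Hp_norm -powRrM mulVf ?powRr1 ?fine_ge0//.
  by rewrite gt_eqF// (lt_trans ltr01).
apply: ge0_ler_powR => //; rewrite ?nnegrE.
- by rewrite (le_trans ler01)// ltW.
- exact: Hp_norm_ge0.
- by apply: le_trans fM; exact: Hp_norm_ge0.
Qed.

(** Integrating [x <= 1 + x ^ p] over the circle, with the p-th power mean at radius [r] bounded by
    the supremum. Finiteness of the integral is checked at the end, so that the real-valued integral
    is the true one. *)
Lemma Hp_circle_bound p f (M r : R) : 1 < p -> 0 < r < 1 -> Hp p f -> Hp_norm p f <= M ->
  (\int[mu]_(t in `[0%R, (pi *+ 2)%R]) cmod (f (r%:C%C * expi t)) <= pi *+ 2 * (1 + M `^ p))%R.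
Proof.
move=> p1 r01 Hf fM; have [/analyticP fD _] := Hf.
have T0 : 0 < pi *+ 2 :> R by exact: T_gt0.
pose h t := cmod (f (r%:C%C * expi t)).
have hm : measurable_fun `[0%R, (pi *+ 2)%R] h.
  apply: subspace_continuous_measurable_fun => //.
  by apply: for_within_continuous => t _; apply: circle_continuous => //; case/andP: r01 => /ltW-> ->.
have hpm : measurable_fun `[0%R, (pi *+ 2)%R] (fun t => h t `^ p).
  exact: (measurableT_comp (measurable_powR _)).
have mT : (mu `[0%R, (pi *+ 2)%R] = (pi *+ 2)%:E)%E.
  by rewrite lebesgue_measure_itv /= lte_fin T0 oppr0 adde0.
have bound : (\int[mu]_(t in `[0%R, (pi *+ 2)%R]) (h t)%:E <= (pi *+ 2 * (1 + M `^ p))%:E)%E.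
  apply: (@le_trans _ _ (\int[mu]_(t in `[0%R, (pi *+ 2)%R]) (1%:E + (h t `^ p)%:E))%E).
    apply: ge0_le_integral => //.
    - by move=> t _; rewrite lee_fin cmod_ge0.
    - exact/measurable_EFinP.
    - by apply: emeasurable_funD => //; exact/measurable_EFinP.
    - by move=> t _; rewrite -EFinD lee_fin le1_powR// cmod_ge0.
  rewrite ge0_integralD//; last 2 first.
  - by move=> t _; rewrite lee_fin powR_ge0.
  - exact/measurable_EFinP.
  rewrite integral_cst// mul1e mulrDr mulr1 EFinD; apply: leeD; first by rewrite -mT.
  rewrite EFinM -lee_pdivrMl//; apply: le_trans (Hp_normp_le p1 Hf fM).
  by apply: ereal_sup_ubound; exists r => //=; rewrite in_itv.
have h0 : (0 <= \int[mu]_(t in `[0%R, (pi *+ 2)%R]) (h t)%:E)%E.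
  by apply: integral_ge0 => t _; rewrite lee_fin cmod_ge0.
rewrite -lee_fin /Rintegral fineK//.
by rewrite ge0_fin_numE//; apply: le_lt_trans bound (ltry _).
Qed.

Lemma Hp_point_bound p (w : C) (M : R) : 1 < p -> in_disk w -> exists B : R,
  forall f, Hp p f -> Hp_norm p f <= M -> cmod (f w) <= B.
Proof.
move=> p1; rewrite in_diskE => w1; have [r [A [r01 A0 H]]] := point_evaluation w1.
exists (A * (pi *+ 2 * (1 + M `^ p))) => f Hf fM.
apply: le_trans (H f _) _; first by apply/analyticP; case: Hf.
by rewrite ler_wpM2l//; exact: Hp_circle_bound.
Qed.

(** * The implications between the three compactness statements *)

Lemma Dop_compact_Cop p phi : self_map phi ->
  compact_op (Sp p) (Sp_norm p) (Sp p) (Sp_norm p) (Dop phi) ->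
  compact_op (@Hp R p) (Hp_norm p) (Sp p) (Sp_norm p) (Cop phi).
Proof.
move=> [_ pm] [Dmap Dcpt].
have CD F f : (forall z, in_disk z -> cderiv F z = f z) ->
    forall z, in_disk z -> Dop phi F z = Cop phi f z.
  by move=> Ff z /pm /Ff.
split=> [f /(Hp_primitive 0)[F [FS _ Ff]]|u uH [M uM]].
  by apply: Sp_congr (CD _ _ Ff) (Dmap _ FS).
(* Primitives vanishing at 0 have [Sp_norm] equal to the [Hp_norm] of [u n], so the bound [M]
   carries over. *)
have /choice[F HF] := fun n => Hp_primitive 0 (uH n).
have [||s [sinc [g [gS gl]]]] := Dcpt F.
- by move=> n; case: (HF n).
- exists M => n; have [_ F0 Fu] := HF n.
  by rewrite /Sp_norm F0 cmod0 add0r (Hp_norm_congr p Fu).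
exists s; split; first exact: sinc.
exists g; split; first exact: gS.
apply: cvg_trans gl; apply: near_eq_cvg; apply: nearW => k.
apply: Sp_norm_congr => z z1 /=.
by have [_ _ Fu] := HF (s k); rewrite (CD _ _ Fu _ z1).
Qed.

(** [Dop phi f] is by definition [Cop phi (cderiv f)], and derivatives of a bounded sequence of S^p
    are bounded in H^p. *)
Lemma Cop_compact_Dop p phi :
  compact_op (@Hp R p) (Hp_norm p) (Sp p) (Sp_norm p) (Cop phi) ->
  compact_op (Sp p) (Sp_norm p) (Sp p) (Sp_norm p) (Dop phi).
Proof.
move=> [Cmap Ccpt]; split=> [f [_ /Cmap //]|u uS [M uM]].
apply: (Ccpt (fun n => cderiv (u n))) => [n|]; first by case: (uS n).
by exists M => n; exact: le_trans (Hp_norm_le_Sp_norm _ _) (uM n).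
Qed.

Lemma DCopB phi u g : self_map phi -> analytic_on_disk u -> analytic_on_disk g ->
  forall z, in_disk z -> cderiv (Cop phi u \- g) z = (DCop phi u \- cderiv g) z.
Proof. by move=> phiS uD gD z; exact: (cderivB (analytic_comp uD phiS) gD). Qed.

(** The S^p norm dominates the H^p norm of the derivative, so convergence survives
    differentiation. *)
Lemma Cop_compact_DCop p phi : self_map phi ->
  compact_op (@Hp R p) (Hp_norm p) (Sp p) (Sp_norm p) (Cop phi) ->
  compact_op (@Hp R p) (Hp_norm p) (@Hp R p) (Hp_norm p) (DCop phi).
Proof.
move=> phiS [Cmap Ccpt]; split=> [f /Cmap[]//|u uH uM].
have [s [sinc [g [[gD gH] gl]]]] := Ccpt u uH uM.
exists s; split; first exact: sinc.
exists (cderiv g); split; first exact: gH.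
apply: (squeeze_cvgr _ (cvg_cst 0) gl); apply: nearW => k; rewrite Hp_norm_ge0 /=.
have [uD _] := uH (s k).
rewrite -(Hp_norm_congr p (DCopB phiS uD gD)).
exact: Hp_norm_le_Sp_norm.
Qed.

Lemma DCop_compact_Cop p phi : 1 < p -> self_map phi ->
  compact_op (@Hp R p) (Hp_norm p) (@Hp R p) (Hp_norm p) (DCop phi) ->
  compact_op (@Hp R p) (Hp_norm p) (Sp p) (Sp_norm p) (Cop phi).
Proof.
move=> p1 phiS [Dmap Dcpt]; split=> [f fH|u uH [M uM]].
  by split; [case: fH => fD _; exact: analytic_comp|exact: Dmap].
have [s1 [s1inc [h [hH hl]]]] := Dcpt u uH (ex_intro _ M uM).
have [B HB] := Hp_point_bound M p1 (phiS.2 _ in_disk0).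
(* Convergence of derivatives leaves the constants free; the values at [phi 0] are bounded, and a
   further subsequence fixes their limit [l], which becomes [g 0]. *)
have [s2 s2inc [l s2l]] := @bolzano_weierstrass_complex R
  (fun k => u (s1 k) (phi 0)) B (fun k => HB _ (uH _) (uM _)).
have [g [[gD gH] g0 gh]] := Hp_primitive l hH.
exists (s1 \o s2); split; first by move=> m n mn; exact/s1inc/s2inc.
exists g; split; first by split; [exact: gD|exact: gH].
have E k : Sp_norm p (Cop phi (u (s1 (s2 k))) \- g) =
    cmod (u (s1 (s2 k)) (phi 0) - l) + Hp_norm p (DCop phi (u (s1 (s2 k))) \- h).
  have [uD _] := uH (s1 (s2 k)).
  have E0 : cmod ((Cop phi (u (s1 (s2 k))) \- g) 0) = cmod (u (s1 (s2 k)) (phi 0) - l).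
    by rewrite -g0.
  apply: (f_equal2 (fun a b : R => a + b) E0); apply: Hp_norm_congr => z z1.
  by rewrite (DCopB phiS uD gD z1) /= -(gh _ z1).
(* The S^p norm splits into the value at 0 and the H^p norm of the derivative; the second term
   converges along [s1], hence along [s2] inside it. *)
suff H : (fun k => cmod (u (s1 (s2 k)) (phi 0) - l) +
    Hp_norm p (DCop phi (u (s1 (s2 k))) \- h)) @ \oo --> (0 : R).
  by apply: cvg_trans H; apply: near_eq_cvg; apply: nearW => k; exact/esym/E.
rewrite -[X in _ --> X]addr0; apply: cvgD.
  apply/cvgrPdist_lt => e /s2l[N HN]; exists N => // n /= /HN.
  by rewrite sub0r normrN ger0_norm// cmod_ge0.
have s2_ge n : (n <= s2 n)%N.
  by elim: n => // n IH; apply: leq_ltn_trans IH _; exact: s2inc.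
apply: (@cvg_comp _ _ _ s2 (fun k => Hp_norm p (DCop phi (u (s1 k)) \- h)) _ _ _ _ hl).
apply/cvgnyPge => N; exists N => // n /= Nn; exact: leq_trans Nn (s2_ge n).
Qed.

End HardySpaces.

Theorem theorem3p8 (R : realType) (p : R) (phi : complex R -> complex R) :
  1 < p -> self_map phi -> Sp p phi ->
  (compact_op (Sp p) (Sp_norm p) (Sp p) (Sp_norm p) (Dop phi) <->
   compact_op (@Hp R p) (Hp_norm p) (Sp p) (Sp_norm p) (Cop phi)) /\
  (compact_op (@Hp R p) (Hp_norm p) (Sp p) (Sp_norm p) (Cop phi) <->
   compact_op (@Hp R p) (Hp_norm p) (@Hp R p) (Hp_norm p) (DCop phi)).
Proof.
move=> p1 phiS _; split; split.
- exact: Dop_compact_Cop.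
- exact: Cop_compact_Dop.
- exact: Cop_compact_DCop.
- exact: DCop_compact_Cop.
Qed.
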